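(* Assume that all weights $a_j$, $j\in J$, are positive and that all functions $g_j=b_j^1t_1+\dots+b_j^kt_k$, $j\in J$, have real coefficients $b_j^i$. Let $z^0\in\Delta$. Then the operators $$\mathrm{pr}\,K_j^1(z^0)|_{\operatorname{Sing}\mathcal F^k(z^0)}:\operatorname{Sing}\mathcal F^k(z^0)\to\operatorname{Sing}\mathcal F^k(z^0),\qquad j\in J,$$ commute and are symmetric with respect to the contravariant form.
   Context: Let $0<k<n$ be integers and $J=\{1,\dots,n\}$. Fix nonzero linear functions $g_j=b_j^1t_1+\dots+b_j^kt_k$, $j\in J$, on $\mathbb C^k$ spanning the dual space of $\mathbb C^k$, and nonzero weights $a=(a_j)_{j\in J}$. For $z\in\mathbb C^n$ put $f_j(z,t)=z_j+g_j(t)$, $H_j(z)=\{t\in\mathbb C^k: f_j(z,t)=0\}$; $\mathcal A(z)=(H_j(z))_{j\in J}$ is an arrangement in $\mathbb C^k$ with complement $U(\mathcal A(z))=\mathbb C^k\setminus\bigcup_jH_j(z)$. A circuit is a subset $C\subset J$ such that $(g_i)_{i\in C}$ is linearly dependent while every proper subset is linearly independent; $\mathfrak C$ is the set of circuits. For $C\in\mathfrak C$ fix numbers $(\lambda^C_i)_{i\in C}$, not all zero, with $\sum_{i\in C}\lambda_i^Cg_i=0$; put $\lambda_i^C=0$ for $i\notin C$, $f_C(z)=\sum_{i\in J}\lambda_i^Cz_i$ and $\Delta=\bigcup_{C\in\mathfrak C}\{f_C=0\}\subset\mathbb C^n$. Spaces. For $z\in\mathbb C^n$ let $\omega_j(z)=dg_j/f_j(z,\cdot)$,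 a form on $U(\mathcal A(z))$; $\mathrm{OS}^p(z)$ is the complex span of all $\omega_{j_1}(z)\wedge\dots\wedge\omega_{j_p}(z)$ ($\mathrm{OS}^0=\mathbb C$), $\mathcal F^k(z)=\mathrm{OS}^k(z)^*$, and $\operatorname{Sing}\mathcal F^k(z)$ is the annihilator of $\nu\wedge\mathrm{OS}^{k-1}(z)$, where $\nu=\sum_ja_j\omega_j(z)$. Call $\{j_1,\dots,j_k\}\subset J$ independent if $g_{j_1},\dots,g_{j_k}$ are linearly independent. For $z\in\mathbb C^n\setminus\Delta$ the forms $\omega_{j_1}(z)\wedge\dots\wedge\omega_{j_k}(z)$ over independent $\{j_1<\dots<j_k\}$ form a basis of $\mathrm{OS}^k(z)$; this identifies all $\mathrm{OS}^k(z)$, $z\notin\Delta$, with one space $V^*$ with basis $(H_{j_1},\dots,H_{j_k})$. Its dual $V=\mathcal F^k(z)$ has the dual basis $F(H_{j_1},\dots,H_{j_k})$ (extended to all orderings by skew-symmetry), and $\operatorname{Sing}V=\operatorname{Sing}\mathcal F^k(z)\subset V$ does not depend on $z\notin\Delta$. The contravariant form $S^{(a)}$ on $V$ is the symmetric bilinear form for which this basis is orthogonal and $S^{(a)}(F(H_{j_1},\dots,H_{j_k}),F(H_{j_1},\dots,H_{j_k}))=a_{j_1}\cdots a_{j_k}$. Operators. For a circuit $C=\{i_1,\dots,i_r\}$ define $L_C:V\to V$ on basis vectors by $L_CF(H_{j_1},\dots,H_{j_k})=0$ if $|\{j_1,\dots,j_k\}\cap C|<r-1$, and, for independent sets containing all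 elements of $C$ but $i_m$, $$L_CF(H_{i_1},\dots,\widehat{H_{i_m}},\dots,H_{i_r},H_{s_1},\dots,H_{s_{k-r+1}})=(-1)^m\sum_{l=1}^r(-1)^la_{i_l}F(H_{i_1},\dots,\widehat{H_{i_l}},\dots,H_{i_r},H_{s_1},\dots,H_{s_{k-r+1}}).$$ All $L_C$ preserve $\operatorname{Sing}V$. Bad fibers. For $z^0\in\Delta$ the map $(H_{j_1},\dots,H_{j_k})\mapsto\omega_{j_1}(z^0)\wedge\dots\wedge\omega_{j_k}(z^0)$ makes $\mathrm{OS}^k(z^0)$ a quotient of $V^*$, so $\mathcal F^k(z^0)\subset V$, and $\operatorname{Sing}\mathcal F^k(z^0)=\mathcal F^k(z^0)\cap\operatorname{Sing}V$. Put $\mathfrak C_0=\{C\in\mathfrak C: f_C(z^0)=0\}$ and $K_j^1(z)=\sum_{C\in\mathfrak C\setminus\mathfrak C_0}\frac{\lambda_j^C}{f_C(z)}L_C$, which is regular at $z^0$. Under the positivity and reality assumptions the subspaces $\operatorname{Sing}V$ and $\operatorname{Sing}\mathcal F^k(z^0)$ are defined over $\mathbb R$, $S^{(a)}$ is positive definite on their real parts, and $\mathrm{pr}:\operatorname{Sing}V\to\operatorname{Sing}\mathcal F^k(z^0)$ denotes the orthogonal projection with respect to $S^{(a)}$. *)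

(* Defs.v *)
From HB Require Import structures.
From mathcomp Require Import all_boot all_order all_fingroup all_algebra.
From mathcomp Require Import boolp classical_sets functions.
Import Order.TTheory GRing.Theory Num.Theory.
Local Open Scope classical_set_scope.
Local Open Scope ring_scope.

(* The functions g_j are encoded by the rows of [b]; a covector with
   coefficients (b_j^1, ..., b_j^k) is identified with [row j b].  Points of
   C^k and C^n are row vectors.  The index set J is 'I_n, so the indices run
   from 0 to n - 1. *)
Section Arrangement.
Context {C : numClosedFieldType} {n k : nat}.
Implicit Types (b : 'M[C]_(n, k)) (a : 'I_n -> C) (z : 'rV[C]_n).
Implicit Types (X : {set 'I_n}) (lambda : {set 'I_n} -> 'I_n -> C).

Definition g b (j : 'I_n) (t : 'rV[C]_k) : C := \sum_(i < k) b j i * t 0 i.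

Definition f b (j : 'I_n) z (t : 'rV[C]_k) : C := z 0 j + g b j t.

Definition complement b z := {t : 'rV[C]_k | [forall j, f b j z t != 0]}.

Definition indep b (s : seq 'I_n) : bool := free [seq row j b | j <- s].

Definition circuit b X : bool :=
  ~~ indep b (enum X) &&
  [forall Y : {set 'I_n}, (Y \proper X) ==> indep b (enum Y)].

(* [lambda X] is a nontrivial linear relation carried by [X], extended by 0. *)
Definition circuit_relations b lambda : Prop :=
  forall X, circuit b X ->
    [/\ exists2 i, i \in X & lambda X i != 0,
        forall i, i \notin X -> lambda X i = 0 &
        \sum_(i in X) lambda X i *: row i b = 0].

Definition fC lambda X z : C := \sum_(i < n) lambda X i * z 0 i.

Definition Delta b lambda : set 'rV[C]_n :=
  [set z | exists2 X, circuit b X & fC lambda X z = 0].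

(* A differential p-form on the complement: its value at a point [t] on the p
   tangent vectors which are the rows of a p x k matrix. *)
Definition form b z (p : nat) := complement b z -> 'M[C]_(p, k) -> C^o.

Definition omega1 b z (j : 'I_n) : form b z 1 :=
  fun t v => g b j v / f b j z (val t).

(* (eta_1 /\ ... /\ eta_p)(v_1, ..., v_p) = det (eta_l (v_m)) for 1-forms. *)
Definition wedge1s {b z p} (eta : 'I_p -> form b z 1) : form b z p :=
  fun t v => \det (\matrix_(l < p, m < p) eta l t (row m v)).

(* (nu /\ eta)(v_0, ..., v_p) =
     \sum_i (-1)^i nu(v_i) eta(v_0, ..., omit v_i, ..., v_p),
   in the normalisation of [wedge1s]. *)
Definition wedge {b z p} (nu : form b z 1) (eta : form b z p.-1) : form b z p :=
  fun t v => \sum_(i < p) (-1) ^+ i * nu t (row i v) * eta t (row' i v).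

Definition omega b z {p} (J : p.-tuple 'I_n) : form b z p :=
  wedge1s (fun l => omega1 b z (tnth J l)).

Definition OS b z p : set (form b z p) :=
  [set eta | exists c : p.-tuple 'I_n -> C,
     eta = \sum_(J : p.-tuple 'I_n) c J *: omega b z J].

Definition nu b a z : form b z 1 := \sum_(j < n) a j *: omega1 b z j.

(* Linear functionals on OS^k(z); the values outside OS^k(z) are irrelevant. *)
Definition OSdual b z : set (form b z k -> C) :=
  [set phi | forall (c : C) (eta eta' : form b z k),
     OS b z k eta -> OS b z k eta' -> phi (c *: eta + eta') = c * phi eta + phi eta'].

(* The basis of V: independent {j_1 < ... < j_k}. *)
Definition indep_tuple b :=
  {J : k.-tuple 'I_n | sorted ltn (map val J) && indep b J}.

Definition V b := {ffun indep_tuple b -> C^o}.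

(* F(H_{j_1}, ..., H_{j_k}) for an arbitrary sequence of indices: the
   skew-symmetric extension of the basis, 0 unless [s] is a rearrangement of
   an independent tuple. *)
Definition F b (s : seq 'I_n) : V b :=
  [ffun I => \sum_(sigma : 'S_k)
     (-1) ^+ sigma * (s == [tuple tnth (val I) (sigma l) | l < k])%:R].

(* F^k(z) = OS^k(z)^* sits in V by transposing the map V^* -> OS^k(z),
   (H_{j_1}, ..., H_{j_k}) |-> omega_{j_1}(z) /\ ... /\ omega_{j_k}(z). *)
Definition toV {b z} (phi : form b z k -> C) : V b :=
  [ffun I => phi (omega b z (val I))].

Definition SingF b a z : set (V b) :=
  toV @` [set phi | OSdual b z phi /\
    forall eta : form b z k.-1, OS b z k.-1 eta ->
      phi (wedge (nu b a z) eta) = 0].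

(* Sing F^k(z) is the same subspace of V for all z outside Delta. *)
Definition SingV b a lambda : set (V b) :=
  [set x | exists2 z, ~ Delta b lambda z & SingF b a z x].

Definition contravariant {b} a (x y : V b) : C :=
  \sum_(I : indep_tuple b) (\prod_(j <- val I) a j) * x I * y I.

(* L_C on the basis vector F(I).  If I contains all elements of the circuit X
   but m, then F(I) = e F(X \ m, s) where s lists I \ X and e = +-1 is the
   coefficient of F(I) in F(X \ m, s).  The positions of m and l in X are
   counted from 0, which does not affect (-1)^m (-1)^l. *)
Definition L_basis {b} a X (I : indep_tuple b) : V b :=
  let s := [seq j <- val I | j \notin X] in
  if (#|[pred j in X | j \in val I]| < #|X|.-1)%N then 0 else
  \sum_(m in X | m \notin val I)
    (F b (rem m (enum X) ++ s) I * (-1) ^+ index m (enum X)) *: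
    \sum_(l in X)
      ((-1) ^+ index l (enum X) * a l) *: F b (rem l (enum X) ++ s).

Definition L {b} a X (x : V b) : V b :=
  \sum_(I : indep_tuple b) x I *: L_basis a X I.

(* K_j^1, built from the circuits with f_C(z0) <> 0, evaluated at z. *)
Definition K1 {b} a lambda (z0 : 'rV[C]_n) (j : 'I_n) z (x : V b) : V b :=
  \sum_(X : {set 'I_n} | circuit b X && (fC lambda X z0 != 0))
    (lambda X j / fC lambda X z) *: L a X x.

Definition is_orth_proj {b} a (W : set (V b)) (x y : V b) : Prop :=
  W y /\ forall w, W w -> contravariant a (x - y) w = 0.

(* The orthogonal projection onto Sing F^k(z0), by choice; the default value 0
   is only returned when no orthogonal projection of [x] exists. *)
Definition pr {b} a (z0 : 'rV[C]_n) (x : V b) : V b :=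
  xget 0 [set y | is_orth_proj a (SingF b a z0) x y].

Definition prK1 {b} a lambda (z0 : 'rV[C]_n) (j : 'I_n) (x : V b) : V b :=
  pr a z0 (K1 a lambda z0 j z0 x).

End Arrangement.

(* Main.v *)
Require Import Defs.
From HB Require Import structures.
From mathcomp Require Import all_boot all_order all_fingroup all_algebra.
From mathcomp Require Import boolp classical_sets functions reals.
From mathcomp Require Import complex.
From mathcomp Require Import ring zify.
Import Order.TTheory GRing.Theory Num.Theory.
Local Open Scope ring_scope.

(** Write W for Sing F^k(z0), orth for orthogonality with respect to the
    contravariant form S, d(s) for the minor of the g_j with rows s, and
    (delta x)(m, s) = x(s) - \sum_q x(s with s_q replaced by m) for the
    boundary of an alternating function of k-tuples.

    A vector x of V is the same thing as an alternating function of k-tuples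
    of indices which vanishes where d does ([ext]).  A set of k + 1 indices
    which spans contains exactly one circuit, so that a combination
    K = \sum_C c(C) L_C becomes
      (K x)(s) = \sum_m a_m c(C(m, s)) (delta x)(m, s)   when d(s) != 0,
    where C(m, s) is the circuit in {m} u s ([L_coord], [ext_circuit_op]).
    Exchanging m with an entry of s shows that
      (k + 1)! S(K x, y) =
        \sum_(m, s) a_m a^s c(C(m, s)) (delta x)(m, s) (delta y)(m, s)
    ([circuit_op_contravariant]): every K is symmetric, and nonnegative when
    c is.  The same exchange shows that K preserves Sing V
    ([circuit_op_singular]).  If c_j(C) = lambda^C_j / f_C(z) with z outside
    Delta, the operators commute on the whole of V: the terms of the commutator
    are paired by exchanging the two new indices m and p, and each pair is
    killed by the three-term relation between the logarithmic differentials of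
    three functions f_C, which are linearly dependent by the Pluecker relations
    ([three_term], [circuit_op_comm]).

    A vector x lies in F^k(z) exactly when (delta x)(m, s) = 0 for all (m, s)
    whose circuit satisfies f_C(z) = 0.  Necessity is the Orlik-Solomon
    relation; sufficiency says that these relations generate all linear
    relations between the functions d(s) / \prod_q f_(s_q) ([completeness]).
    This goes by induction on k.  The polar part of highest order at a vertex
    reduces an affine arrangement to central ones, and restricting a central
    arrangement in C^k to the affine hyperplane g_j = 1 reduces it to an affine
    arrangement in C^(k-1).

    Now let v be a point outside Delta and z = z0 + e v.  Then
      K_j(z) = e^-1 M_j + K_j^1(z),   M_j = \sum_(C in C_0) lambda^C_j / f_C(v) L_C.
    The M_j vanish on W, and commutativity of the K_j(z) for almost all e gives
      M_i M_j = M_j M_i,   M_i K_j^1 w = M_j K_i^1 w,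
      S(K_j^1 w, K_i^1 w') = S(K_i^1 w, K_j^1 w')   for w, w' in W.
    The limit e -> 0 is taken on polynomial identities in e, after clearing
    denominators.  The sum L0 = \sum_j v_j M_j = \sum_(C in C_0) L_C is
    nonnegative, and by the description of F^k(z0) its kernel in Sing V is W,
    so L0 is invertible on the orthogonal E of W in Sing V.  Put
    u_j(w) = K_j^1 w - pr K_j^1 w, an element of E, and choose p in E with
    L0 p = \sum_j v_j u_j(w).  Then L0 (u_i(w) - M_i p) = 0, that is
    u_i(w) = M_i p: the normal parts have a common potential.  Hence
    S(u_j(w), u_i(w')) = S(M_i M_j p, p') is symmetric in i and j.  As
      S(pr K_j^1 w, pr K_i^1 w') = S(K_j^1 w, K_i^1 w') - S(u_j(w), u_i(w')),
    the operators pr K_j^1 on W commute. *)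

(** * Alternating functions of k-tuples *)

Definition upd {T : Type} {k} (s : 'I_k -> T) (q : 'I_k) (m : T) : 'I_k -> T :=
  fun i => if i == q then m else s i.

Section Cochains.
Context {C : numFieldType} {T : Type} {k : nat}.
Implicit Types (x : ('I_k -> T) -> C) (s : 'I_k -> T) (m p : T) (q : 'I_k).

Definition alternating x := forall s (w : 'S_k), x (s \o w) = (-1) ^+ w * x s.

(** The boundary of x on the (k + 1)-tuple (m, s): dropping s_q and moving m to
    its place absorbs the sign of the q-th face. *)
Definition delta x m s : C := x s - \sum_q x (upd s q m).

Lemma upd_id s q : upd s q (s q) = s.
Proof. by apply/funext => i; rewrite /upd; case: eqP => // ->. Qed.

Lemma upd_eq s q m : upd s q m q = m.
Proof. by rewrite /upd eqxx. Qed.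

Lemma upd_upd s q m p : upd (upd s q m) q p = upd s q p.
Proof. by apply/funext => i; rewrite /upd; case: eqP. Qed.

Lemma upd_comm s q q' m p : q != q' ->
  upd (upd s q m) q' p = upd (upd s q' p) q m.
Proof.
move=> nq; apply/funext => i; rewrite /upd.
by case: (i =P q') => [->|] //; rewrite eq_sym (negbTE nq).
Qed.

Lemma upd_perm s (w : 'S_k) q m : upd (s \o w) q m = upd s (w q) m \o w.
Proof. by apply/funext => i; rewrite /upd /= (inj_eq perm_inj). Qed.

Lemma alt_tperm x s q q' : alternating x -> q != q' ->
  x (s \o tperm q q') = - x s.
Proof. by move=> ax nq; rewrite ax odd_tperm nq expr1 mulN1r. Qed.

Lemma alt_swap x s q q' m p : alternating x -> q != q' ->
  x (upd (upd s q m) q' p) = - x (upd (upd s q p) q' m).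
Proof.
move=> ax nq; rewrite -(alt_tperm x _ q q' ax nq); congr x; apply/funext => i.
rewrite /= /upd; case: tpermP => [->|->|/eqP/negbTE-> /eqP/negbTE->] //.
  by rewrite !eqxx (negbTE nq).
by rewrite !eqxx (negbTE nq).
Qed.

Lemma eqN_eq0 (u : C) : u = - u -> u = 0.
Proof. by move/eqP; rewrite -addr_eq0 -mulr2n mulrn_eq0 => /eqP. Qed.

Lemma alt_repeat x s q q' : alternating x -> q != q' -> s q = s q' -> x s = 0.
Proof.
move=> ax nq e; apply: eqN_eq0; rewrite -(alt_tperm x s q q' ax nq).
by congr x; apply/funext => i /=; case: tpermP => [->|->|].
Qed.

(** Both sides are the boundary on the same k + 1 entries, in orders which
    differ by one transposition. *)
Lemma delta_swap x s q m p : alternating x ->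
  delta x p (upd s q m) = - delta x m (upd s q p).
Proof.
move=> ax; apply/eqP; rewrite -subr_eq0 opprK /delta.
rewrite (bigD1 q) //= [X in _ + (_ - X)](bigD1 q) //= !upd_upd.
set S := \sum_(_ | _) _; set S' := \sum_(_ | _) _.
have -> : S' = - S.
  rewrite -sumrN; apply: eq_bigr => i ni.
  by rewrite alt_swap // eq_sym.
by apply/eqP; ring.
Qed.

Lemma delta_exchange x s q m : alternating x ->
  delta x (s q) (upd s q m) = - delta x m s.
Proof. by move=> ax; rewrite delta_swap // upd_id. Qed.

Lemma delta_mem x s q : alternating x -> delta x (s q) s = 0.
Proof.
by move=> ax; apply: eqN_eq0; have := delta_exchange x s q (s q) ax; rewrite upd_id.
Qed.

(** The boundary of a boundary vanishes, on the k + 2 entries (m, p, s). *)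
Lemma delta_delta x s m p : alternating x ->
  delta x p s - delta x m s = \sum_q delta x p (upd s q m).
Proof.
move=> ax; rewrite {3}/delta sumrB.
have -> : \sum_q \sum_q' x (upd (upd s q m) q' p) = \sum_q x (upd s q p).
  pose G q q' := x (upd (upd s q m) q' p).
  have Gd q : \sum_q' G q q' = x (upd s q p) + \sum_(q' | q' != q) G q q'.
    by rewrite (bigD1 q) //= /G upd_upd.
  under eq_bigr => q _ do rewrite Gd.
  rewrite big_split /= [X in _ + X](_ : _ = 0) ?addr0 //.
  apply: eqN_eq0; rewrite {1}(exchange_big_dep xpredT) //= -sumrN.
  apply: eq_bigr => q _; rewrite -sumrN.
  apply: eq_big => [q'|q' nq]; first by rewrite eq_sym.
  by rewrite /G -alt_swap // upd_comm // eq_sym.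
by rewrite /delta; ring.
Qed.

Lemma delta_perm x s (w : 'S_k) m : alternating x ->
  delta x m (s \o w) = (-1) ^+ w * delta x m s.
Proof.
move=> ax; rewrite /delta ax mulrBr; congr (_ - _).
rewrite mulr_sumr [RHS](reindex_inj (@perm_inj _ w)).
by apply: eq_bigr => q _; rewrite upd_perm ax.
Qed.

End Cochains.

(** Two faces of a (k + 1)-tuple become equal up to order once the entry missing
    from the one takes the place of the entry missing from the other; the
    permutation that compares them is a cycle between the two positions. *)
Lemma alt_face {C : numFieldType} {T : Type} {k} (x : ('I_k -> T) -> C)
    (U : 'I_k.+1 -> T) (p : 'I_k.+1) (q : 'I_k) : alternating x ->
  x (upd (U \o lift p) q (U p)) = - (-1) ^+ (p + lift p q) * x (U \o lift (lift p q)).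
Proof.
case: k x U p q => [|k'] x U p q ax; first by case: q.
have rp : lift p q != p by rewrite eq_sym neq_lift.
have [p' pE _] := unlift_some rp.
have p'E : p' = unbump q p :> nat.
  have := congr1 val pE; rewrite /= => E; rewrite -(bumpK (bump p q) p') -E.
  by rewrite /unbump /bump; case: ltngtP => //=; lia.
(* Removing two entries does not depend on the order of removal. *)
have liftE i : lift (lift p q) (lift p' i) = lift p (lift q i).
  by apply: val_inj; rewrite /= p'E -bumpC.
have -> : upd (U \o lift p) q (U p) = (U \o lift (lift p q)) \o lift_perm q p' 1.
  apply/funext => i; rewrite /upd /=; case: (unliftP q i) => [j|] ->.
    by rewrite lift_perm_lift perm1 liftE eq_sym (negbTE (neq_lift _ _)).
  by rewrite lift_perm_id eqxx -pE.
rewrite ax odd_lift_perm odd_perm1 addbF; congr (_ * _).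
rewrite -[in RHS]signr_odd -signrN; congr (_ ^+ nat_of_bool _).
rewrite oddD /= p'E /unbump /bump; case: (ltngtP p q) => /=; lia.
Qed.

(** The alternating sum over faces may be read off from any chosen entry. *)
Lemma delta_faces {C : numFieldType} {T : Type} {k} (x : ('I_k -> T) -> C)
    (U : 'I_k.+1 -> T) (p : 'I_k.+1) : alternating x ->
  \sum_(l < k.+1) (-1) ^+ l * x (U \o lift l) =
    (-1) ^+ p * delta x (U p) (U \o lift p).
Proof.
move=> ax; rewrite (bigD1_ord p) //= /delta mulrBr mulr_sumr -sumrN.
congr (_ + _); apply: eq_bigr => q _; rewrite alt_face // exprD.
by rewrite !(mulNr, mulrN) opprK !mulrA -expr2 sqrr_sign mul1r.
Qed.

(** * Minors and the relation carried by k + 1 covectors *)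

HB.lock Definition minor {C : numFieldType} {n k : nat} (b : 'M[C]_(n, k))
  (s : 'I_k -> 'I_n) : C := \det (rowsub s b).

Section Minors.
Context {C : numFieldType} {n k : nat}.
Implicit Types (b : 'M[C]_(n, k)) (s : 'I_k -> 'I_n) (y : 'I_n -> C).

Lemma alternating_minor b : alternating (minor b).
Proof.
move=> s w; rewrite minor.unlock.
have -> : rowsub (s \o w) b = row_perm w (rowsub s b).
  by apply/matrixP => i j; rewrite !mxE.
by rewrite row_permE det_mulmx det_perm.
Qed.

(** Both sides are the Laplace expansion along the new row q. *)
Lemma minor_upd b s q m :
  minor b (upd s q m) = (b *m \adj (rowsub s b)) m q.
Proof.
rewrite minor.unlock (expand_det_row _ q) mxE; apply: eq_bigr => j _.
rewrite !mxE upd_eq; congr (_ * _); rewrite /cofactor; congr (_ * \det _).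
by apply/matrixP => i l; rewrite !mxE /upd eq_sym (negbTE (neq_lift _ _)).
Qed.

Lemma cramer b s m :
  \sum_q minor b (upd s q m) *: row (s q) b = minor b s *: row m b.
Proof.
apply/rowP => j; rewrite summxE.
transitivity ((b *m \adj (rowsub s b) *m rowsub s b) m j).
  by rewrite mxE; apply: eq_bigr => q _; rewrite minor_upd !mxE.
by rewrite -mulmxA mul_adj_mx mul_mx_scalar !mxE minor.unlock.
Qed.

Lemma minor_free b s (beta : 'I_k -> C) : minor b s != 0 ->
  \sum_q beta q *: row (s q) b = 0 -> beta =1 fun=> 0.
Proof.
move=> ds e q; have us : rowsub s b \in unitmx.
  by rewrite unitmxE unitfE; move: ds; rewrite minor.unlock.
have : (\row_q beta q) *m rowsub s b = 0.
  rewrite -[RHS]e; apply/rowP => j; rewrite summxE mxE.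
  by apply: eq_bigr => i _; rewrite !mxE.
move/(congr1 (mulmx^~ (invmx (rowsub s b)))); rewrite mulmxK // mul0mx.
by move/(congr1 (fun v : 'rV_k => v 0 q)); rewrite !mxE.
Qed.

Lemma minor_inj b s : minor b s != 0 -> injective s.
Proof.
move=> ds i j e; apply/eqP; apply: contraNT ds => ij.
by apply/eqP/(alt_repeat _ _ i j (alternating_minor b)).
Qed.

(** Expanding the covectors m and p in the basis s by Cramer's rule gives a linear
    relation between the g_(s_i) alone; its coefficients therefore vanish, and
    the one at q' is this identity. *)
Lemma plucker b s q q' m p : minor b s != 0 -> q' != q ->
  minor b s * minor b (upd (upd s q m) q' p) =
  minor b (upd s q m) * minor b (upd s q' p)
    - minor b (upd s q p) * minor b (upd s q' m).
Proof.
move=> ds nq; pose u := upd s q m.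
pose be i := minor b u * minor b (upd s i p)
   - minor b (upd s q p) * minor b (upd s i m)
   - (i != q)%:R * (minor b s * minor b (upd u i p)).
suff be0 : be =1 fun=> 0.
  by move: (be0 q'); rewrite /be nq mul1r => /eqP; rewrite subr_eq0 => /eqP.
apply: (minor_free b s) => //.
have lin (c : C) v m' : \sum_i (c * minor b (upd v i m')) *: row (v i) b
    = c *: (minor b v *: row m' b).
  by rewrite -cramer scaler_sumr; apply: eq_bigr => i _; rewrite scalerA.
under eq_bigr => i _ do rewrite /be !scalerBl.
rewrite !sumrB !lin.
have -> : \sum_i ((i != q)%:R * (minor b s * minor b (upd u i p))) *: row (s i) b
   = minor b s *: (minor b u *: row p b - minor b (upd s q p) *: row m b).
  rewrite scalerBr -(lin _ u) (bigD1 q) //= eqxx mul0r scale0r add0r.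
  rewrite [in RHS](bigD1 q) //= /u upd_upd upd_eq scalerA addrAC subrr add0r.
  by apply: eq_bigr => i ni; rewrite ni mul1r /u /upd (negbTE ni).
by rewrite scalerBr !scalerA [minor b s * minor b u]mulrC
   [minor b s * minor b (upd s q p)]mulrC subrr.
Qed.

(** The linear relation between g_m and the g_(s_q) given by Cramer's rule,
    evaluated at the numbers y in place of the covectors.  When s is a basis
    which does not contain m, and C is the circuit in {m} u s, it is f_C(z) up to
    a nonzero factor for y = z, and lambda^C_i up to the same factor for y the
    indicator of i. *)
Definition fundrel b y m s : C :=
  y m * minor b s - \sum_q y (s q) * minor b (upd s q m).

Lemma fundrel_col b j m s : fundrel b (fun i => b i j) m s = 0.
Proof.
have := congr1 (fun v : 'rV_k => v 0 j) (cramer b s m).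
rewrite summxE !mxE /fundrel [b m j * _]mulrC => <-.
apply/eqP; rewrite subr_eq0; apply/eqP; apply: eq_bigr => q _.
by rewrite !mxE mulrC.
Qed.

(** Exchanging an entry of the basis s makes three relations on k + 2 covectors
    linearly dependent. *)
Lemma fundrel_plucker b y s q m p : minor b s != 0 ->
  minor b s * fundrel b y p (upd s q m) =
  minor b (upd s q m) * fundrel b y p s - minor b (upd s q p) * fundrel b y m s.
Proof.
move=> ds; rewrite /fundrel !mulrBr !mulr_sumr (bigD1 q) //=.
rewrite [X in _ = _ - X - _](bigD1 q) //= [X in _ = _ - (_ - X)](bigD1 q) //=.
rewrite upd_upd upd_eq.
set A := \sum_(_ | _) _; set B := \sum_(_ | _) _; set D := \sum_(_ | _) _.
have -> : A = B - D.
  rewrite /A /B /D -sumrB; apply: eq_bigr => i ni; rewrite [upd s q m i]/upd (negbTE ni).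
  rewrite mulrCA plucker //; ring.
ring.
Qed.

Lemma fundrel_mem b y s q : minor b s != 0 -> fundrel b y (s q) s = 0.
Proof.
move=> ds; rewrite /fundrel (bigD1 q) //= upd_id opprD addrA subrr sub0r big1 ?oppr0 // => i ni.
rewrite (alt_repeat _ _ i q (alternating_minor b)) ?mulr0 //.
by rewrite upd_eq /upd eq_sym (negbTE ni).
Qed.
Lemma fundrel_exchange b y m s q : fundrel b y (s q) (upd s q m) = - fundrel b y m s.
Proof.
rewrite /fundrel (bigD1 q) //= upd_eq upd_upd upd_id [in RHS](bigD1 q) //=.
set S := \sum_(_ | _) _; set S' := \sum_(_ | _) _.
have -> : S = - S'.
  rewrite -sumrN; apply: eq_bigr => i ni; rewrite {1}/upd (negbTE ni).
  rewrite alt_swap; [|exact: alternating_minor|by rewrite eq_sym].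
  by rewrite upd_id mulrN.
by ring.
Qed.
End Minors.

(** * Polynomial functions of one parameter *)

Section PolyFun.
Context {C : numFieldType}.
Implicit Types (h r : C -> C).

(** Only the values of the polynomial matter below, and they are obtained from
    sums and products of scalars without exhibiting its coefficients. *)
Definition polyfun h := exists p : {poly C}, forall e, h e = p.[e].

Lemma polyfun_cst (c : C) : polyfun (fun=> c).
Proof. by exists c%:P => e; rewrite hornerC. Qed.

Lemma polyfun_id : polyfun id.
Proof. by exists 'X => e; rewrite hornerX. Qed.

Lemma polyfunD h r : polyfun h -> polyfun r -> polyfun (fun e => h e + r e).
Proof. by move=> [p ph] [q qr]; exists (p + q) => e; rewrite hornerD ph qr. Qed.

Lemma polyfunM h r : polyfun h -> polyfun r -> polyfun (fun e => h e * r e).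
Proof. by move=> [p ph] [q qr]; exists (p * q) => e; rewrite hornerM ph qr. Qed.

Lemma polyfunB h r : polyfun h -> polyfun r -> polyfun (fun e => h e - r e).
Proof. by move=> [p ph] [q qr]; exists (p - q) => e; rewrite hornerD hornerN ph qr. Qed.

Lemma polyfun_sum (I : Type) (l : seq I) (P : pred I) (F : I -> C -> C) :
  (forall i, P i -> polyfun (F i)) -> polyfun (fun e => \sum_(i <- l | P i) F i e).
Proof.
move=> pF; elim: l => [|i l IH].
  by exists 0 => e; rewrite big_nil horner0.
have [Pi|nPi] := boolP (P i).
  have [p ph] := polyfunD _ _ (pF i Pi) IH.
  by exists p => e; rewrite big_cons Pi -ph.
by have [p ph] := IH; exists p => e; rewrite big_cons (negbTE nPi) -ph.
Qed.

Lemma polyfun_prod (I : Type) (l : seq I) (P : pred I) (F : I -> C -> C) :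
  (forall i, P i -> polyfun (F i)) -> polyfun (fun e => \prod_(i <- l | P i) F i e).
Proof.
move=> pF; elim: l => [|i l IH].
  by exists 1 => e; rewrite big_nil hornerC.
have [Pi|nPi] := boolP (P i).
  have [p ph] := polyfunM _ _ (pF i Pi) IH.
  by exists p => e; rewrite big_cons Pi -ph.
by have [p ph] := IH; exists p => e; rewrite big_cons (negbTE nPi) -ph.
Qed.

Lemma poly_fun0 (p : {poly C}) : (forall e, p.[e] = 0) -> p = 0.
Proof.
move=> p0; apply/eqP; apply/negPn/negP => pn0.
pose rs := [seq i%:R : C | i <- iota 0 (size p)].
have rootrs : all (root p) rs by apply/allP => e _; apply/rootP.
have uniqrs : uniq rs.
  rewrite map_inj_uniq ?iota_uniq // => i j /eqP.
  by rewrite eqr_nat => /eqP.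
by have := max_poly_roots pn0 rootrs uniqrs; rewrite size_map size_iota ltnn.
Qed.

(** Identities between polynomials extend across the zeros of a nonzero
    polynomial r: the product h r vanishes everywhere. *)
Lemma polyfun_eq0 h r e0 : polyfun h -> polyfun r -> r e0 != 0 ->
  (forall e, r e != 0 -> h e = 0) -> forall e, h e = 0.
Proof.
move=> [p ph] [q qr] r0 hr e.
have /poly_fun0/eqP : forall x, (p * q).[x] = 0.
  move=> x; rewrite hornerM -ph -qr; have [->|rx] := eqVneq (r x) 0.
    by rewrite mulr0.
  by rewrite hr // mul0r.
rewrite mulf_eq0 => /orP[]/eqP E; first by rewrite ph E horner0.
by move: r0; rewrite qr E horner0 eqxx.
Qed.

(** Used as a limit e -> 0 which is purely algebraic. *)
Lemma polyfun_limit h r : polyfun h -> polyfun r -> r 0 != 0 ->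
  (forall e, e != 0 -> r e != 0 -> h e = 0) -> h 0 = 0.
Proof.
move=> ph pr r0 hr.
have eh : forall e, e * h e = 0.
  apply: (polyfun_eq0 _ _ _ (polyfunM _ _ polyfun_id ph) pr r0) => e re.
  by have [->|e0] := eqVneq e 0; rewrite ?mul0r // hr // mulr0.
apply: (polyfun_eq0 _ _ _ ph polyfun_id (oner_neq0 C)) => e e0.
by apply/eqP; have /eqP := eh e; rewrite mulf_eq0 (negbTE e0).
Qed.
End PolyFun.

(** * Prepending an entry to a tuple *)

Section Cons.
Context {T : Type} {k : nat}.
Implicit Types (J : 'I_k -> T) (m : T).

Definition cons_fun m J : 'I_k.+1 -> T :=
  fun i => if unlift ord0 i is Some j then J j else m.

Lemma cons_fun0 m J : cons_fun m J ord0 = m.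
Proof. by rewrite /cons_fun unlift_none. Qed.

Lemma cons_funS m J i : cons_fun m J (lift ord0 i) = J i.
Proof. by rewrite /cons_fun liftK. Qed.

Lemma upd_cons_fun0 m J p : upd (cons_fun m J) ord0 p = cons_fun p J.
Proof.
apply/funext => i; rewrite /upd; case: (unliftP ord0 i) => [j|] ->.
  by rewrite !cons_funS eq_sym (negbTE (neq_lift _ _)).
by rewrite eqxx cons_fun0.
Qed.

Lemma upd_cons_funS m J q p : upd (cons_fun m J) (lift ord0 q) p = cons_fun m (upd J q p).
Proof.
apply/funext => i; rewrite /upd; case: (unliftP ord0 i) => [j|] ->.
  by rewrite !cons_funS (inj_eq lift_inj).
by rewrite !cons_fun0 (negbTE (neq_lift _ _)).
Qed.

Lemma upd_alternating_cons {C : numFieldType} (x : ('I_k.+1 -> T) -> C) s q m :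
  alternating x -> x (upd s q m) = (-1) ^+ q * x (cons_fun m (s \o lift q)).
Proof.
move=> ax; have -> : upd s q m = cons_fun m (s \o lift q) \o lift_perm q ord0 1.
  apply/funext => i; rewrite /upd /=; case: (unliftP q i) => [j|] ->.
    by rewrite lift_perm_lift perm1 cons_funS /= eq_sym (negbTE (neq_lift _ _)).
  by rewrite lift_perm_id eqxx cons_fun0.
by rewrite ax odd_lift_perm odd_perm1 !addbF signr_odd.
Qed.

Lemma delta_cons_fun {C : numFieldType} (x : ('I_k.+1 -> T) -> C) p m J :
  delta x p (cons_fun m J) =
  x (cons_fun m J) - x (cons_fun p J) - \sum_q x (cons_fun m (upd J q p)).
Proof.
rewrite /delta big_ord_recl upd_cons_fun0 opprD addrA; congr (_ - _).
by apply: eq_bigr => q _; rewrite -upd_cons_funS.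
Qed.

Lemma alternating_cons_fun {C : numFieldType} (x : ('I_k.+1 -> T) -> C) m :
  alternating x -> alternating (fun J => x (cons_fun m J)).
Proof.
move=> ax J w; have -> : cons_fun m (J \o w) = cons_fun m J \o lift_perm ord0 ord0 w.
  apply/funext => i; case: (unliftP ord0 i) => [j|] -> /=.
    by rewrite lift_perm_lift !cons_funS.
  by rewrite lift_perm_id !cons_fun0.
by rewrite ax odd_lift_perm.
Qed.
End Cons.

(** Expansion along the first column: a minor of a central arrangement in
    C^(k+1) is the relation [fundrel] of the affine arrangement in C^k whose
    constant terms form that column. *)
Lemma minor_cons_fun {C : numFieldType} {n k} (b : 'M[C]_(n, k.+1)) m J :
  minor b (cons_fun m J) = fundrel (col' ord0 b) (fun j => b j ord0) m J.
Proof.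
have cofE (U : 'I_k.+1 -> 'I_n) l : cofactor (rowsub U b) l ord0 =
    (-1) ^+ l * minor (col' ord0 b) (U \o lift l).
  rewrite /cofactor minor.unlock addn0; congr (_ * \det _).
  by apply/matrixP => i j; rewrite !mxE.
rewrite minor.unlock (expand_det_col _ ord0) big_ord_recl cofE expr0 mul1r mxE.
rewrite cons_fun0 /fundrel -sumrN; congr (_ * minor _ _ + _).
  by apply/funext => i /=; rewrite cons_funS.
apply: eq_bigr => q _; rewrite cofE mxE cons_funS -mulrN; congr (_ * _).
have := alt_face (minor (col' ord0 b)) (cons_fun m J) ord0 q (alternating_minor _).
rewrite cons_fun0 add0n (_ : cons_fun m J \o lift ord0 = J); last first.
  by apply/funext => i /=; rewrite cons_funS.
by move=> ->; rewrite mulNr opprK.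
Qed.

Lemma minor_cons_unit {C : numFieldType} {n k} (b : 'M[C]_(n, k.+1)) m J :
  row m b = delta_mx 0 ord0 -> minor b (cons_fun m J) = minor (col' ord0 b) J.
Proof.
move=> bm; have bE i : b m i = (i == ord0)%:R.
  by have := congr1 (fun v : 'rV_k.+1 => v 0 i) bm; rewrite !mxE eqxx.
rewrite minor.unlock (expand_det_row _ ord0) big_ord_recl mxE cons_fun0 bE mul1r.
rewrite big1 ?addr0 => [|i _].
  rewrite /cofactor expr0 mul1r; congr (\det _).
  by apply/matrixP => i j; rewrite !mxE cons_funS.
by rewrite mxE cons_fun0 bE mul0r.
Qed.

(** * Linear relations between the products of k factors 1 / f_j *)

Section Completeness.
Context {C : numClosedFieldType} {n : nat}.
Implicit Types (A : {set 'I_n}).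

(** The functionals which respect the Orlik-Solomon relations of the hyperplanes
    with index in A: [fundrel] vanishes at z exactly when the k + 1 affine
    functions f_m, f_(s_q) are linearly dependent. *)
Definition adapted {k} (b : 'M[C]_(n, k)) (z : 'rV[C]_n) A
    (x : ('I_k -> 'I_n) -> C) :=
  [/\ alternating x,
      forall s, (forall q, s q \in A) -> minor b s = 0 -> x s = 0 &
      forall m s, m \in A -> (forall q, s q \in A) ->
        fundrel b (z 0) m s = 0 -> delta x m s = 0].

(** Families indexed by an arbitrary finite type let the coefficients be
    transported from one arrangement to another without collecting equal
    tuples. *)
Definition complete {k} (b : 'M[C]_(n, k)) (z : 'rV[C]_n) A :=
  forall x, adapted b z A x ->
  forall (I : finType) (P : pred I) (c : I -> C) (e : I -> 'I_k -> 'I_n),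
  (forall i, P i -> forall q, e i q \in A) ->
  (forall t, (forall j, j \in A -> f b j z t != 0) ->
     \sum_(i | P i) c i * (minor b (e i) / \prod_q f b (e i q) z t) = 0) ->
  \sum_(i | P i) c i * x (e i) = 0.

Lemma gE {k} (b : 'M[C]_(n, k)) j t : g b j t = (b *m t^T) j 0.
Proof. by rewrite mxE; apply: eq_bigr => i _; rewrite mxE. Qed.

Lemma f0E {k} (b : 'M[C]_(n, k)) j t : f b j 0 t = g b j t.
Proof. by rewrite /f mxE add0r. Qed.

Lemma fundrel_g {k} (b : 'M[C]_(n, k)) t m s : fundrel b (fun j => g b j t) m s = 0.
Proof.
have gE' j : g b j t = (row j b *m t^T) 0 0 by rewrite gE -row_mul [RHS]mxE.
have := congr1 (fun v : 'rV_k => (v *m t^T) 0 0) (cramer b s m).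
rewrite mulmx_suml summxE -scalemxAl [RHS]mxE -gE' => E.
rewrite /fundrel mulrC -E; apply/eqP; rewrite subr_eq0; apply/eqP.
by apply: eq_bigr => q _; rewrite gE' -scalemxAl mxE mulrC.
Qed.

(** The linear parts satisfy the relation identically, so only the constant
    terms contribute. *)
Lemma fundrel_f {k} (b : 'M[C]_(n, k)) z t m s :
  fundrel b (fun j => f b j z t) m s = fundrel b (z 0) m s.
Proof.
rewrite -[RHS]addr0 -(fundrel_g b t m s) /fundrel /f addrACA -opprD -big_split mulrDl.
by congr (_ - _); apply: eq_bigr => q _; rewrite mulrDl.
Qed.

Lemma fundrel0 {k} (b : 'M[C]_(n, k)) m s : fundrel b ((0 : 'rV_n) 0) m s = 0.
Proof.
by rewrite /fundrel mxE mul0r big1 ?subr0 // => q _; rewrite mxE mul0r.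
Qed.

Lemma complete_dim0 (b : 'M[C]_(n, 0)) A : complete b 0 A.
Proof.
move=> x [ax _ dx] I P c e eA hyp.
(* In dimension 0 a hyperplane through the origin is the whole space, which
   forces x to vanish. *)
have [A0|[m mA]] := set_0Vmem A; last first.
  apply: big1 => i Pi; have := dx m (e i) mA (eA i Pi).
  rewrite /fundrel mxE mul0r !big_ord0 subr0 /delta big_ord0 subr0 => -> //.
  by rewrite mulr0.
have /hyp hyp0 : forall j, j \in A -> f b j 0 0 != 0 by move=> j; rewrite A0 inE.
have ord0_fun (s s' : 'I_0 -> 'I_n) : s = s' by apply/funext => -[].
pose s0 : 'I_0 -> 'I_n := fun i => match i with Ordinal _ h => match notF h with end end.
under eq_bigr => i _ do rewrite (ord0_fun (e i) s0).
rewrite -mulr_suml (_ : \sum_(i | P i) c i = 0) ?mul0r // -[RHS]hyp0.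
by apply: eq_bigr => i _; rewrite minor.unlock det_mx00 big_ord0 divr1 mulr1.
Qed.

(** A linear change of coordinates in C^k multiplies all minors by one
    constant. *)
Lemma complete_mulmx {k} (b : 'M[C]_(n, k)) A (Q : 'M[C]_k) :
  Q \in unitmx -> complete (b *m Q) 0 A -> complete b 0 A.
Proof.
move=> uQ bQ x [ax mx dx] I P c e eA hyp.
have detQ : \det Q != 0 by rewrite -unitfE -unitmxE.
have minorQ s : minor (b *m Q) s = minor b s * \det Q.
  rewrite minor.unlock -det_mulmx; congr (\det _).
  by rewrite -!mul_rowsub_mx.
apply: (bQ x) => //.
  split=> // [s sA /eqP|m s mA sA _].
    by rewrite minorQ mulf_eq0 (negbTE detQ) orbF => /eqP; apply: mx.
  apply: dx => //; exact: fundrel0.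
move=> t tA.
have fQ j : f (b *m Q) j 0 t = f b j 0 (t *m Q^T).
  by rewrite !f0E !gE trmx_mul trmxK mulmxA.
rewrite -[RHS](mul0r (\det Q)) -[X in _ = X * _](hyp (t *m Q^T)); last first.
  by move=> j jA; rewrite -fQ tA.
rewrite mulr_suml; apply: eq_bigr => i _; rewrite minorQ.
under eq_bigr => q _ do rewrite fQ.
by rewrite -!mulrA; congr (_ * (_ * _)); rewrite mulrC.
Qed.

Lemma row_to_delta {k} (v : 'rV[C]_k.+1) : v != 0 ->
  exists2 Q, Q \in unitmx & v *m Q = delta_mx 0 ord0.
Proof.
move=> v0; have r1 : \rank v = 1%N.
  by apply/eqP; rewrite eqn_leq rank_leq_row lt0n mxrank_eq0.
pose a := col_ebase v 0 0.
have a0 : a != 0.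
  have := col_ebase_unit v; rewrite unitmxE unitfE.
  by rewrite [col_ebase v]mx11_scalar det_scalar1.
exists (a^-1 *: invmx (row_ebase v)).
  by rewrite unitmxZ ?unitfE ?invr_eq0 // unitmx_inv row_ebase_unit.
rewrite -{1}(mulmx_ebase v) r1 -scalemxAr -!mulmxA mulmxV ?row_ebase_unit //.
rewrite mulmx1 [col_ebase v]mx11_scalar mul_scalar_mx scalerA mulVf // scale1r.
apply/matrixP => i j; rewrite !mxE !ord1 /= -val_eqE /=.
by case: (j : nat).
Qed.

(** A central arrangement restricted to the hyperplane g_(j0) = 1, in coordinates
    where g_(j0) is the first one.  The relation with j0 writes every function
    d(s) / \prod g, and in the same way every value x(s), in terms of tuples
    containing j0; these are the functions and the tuples of the restricted
    arrangement. *)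
Lemma complete_decone {k} (b : 'M[C]_(n, k.+1)) A j0 :
  j0 \in A -> row j0 b = delta_mx 0 ord0 ->
  complete (col' ord0 b) (col ord0 b)^T A -> complete b 0 A.
Proof.
set b' := col' ord0 b; set z' := (col ord0 b)^T.
move=> j0A bj0 cb x [ax mx dx] I P c e eA hyp.
have dx0 m s : m \in A -> (forall q, s q \in A) -> delta x m s = 0.
  move=> mA sA; apply: dx => //; exact: fundrel0.
have z'E : z' 0 = (fun j => b j ord0) by apply/funext => j; rewrite !mxE.
have cnsA m J : m \in A -> (forall q, J q \in A) -> forall q, cons_fun m J q \in A.
  by move=> mA JA q; case: (unliftP ord0 q) => [i|] ->; rewrite ?cons_funS ?cons_fun0.
pose x' J := x (cons_fun j0 J).
have xE s : (forall q, s q \in A) ->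
    x s = \sum_(q < k.+1) (-1) ^+ q * x' (s \o lift q).
  move=> sA; have /eqP := dx0 j0 s j0A sA; rewrite subr_eq0 => /eqP ->.
  by apply: eq_bigr => q _; rewrite upd_alternating_cons.
have := cb x' _ (I * 'I_k.+1)%type (fun p => P p.1 && xpredT p.2)
   (fun p => c p.1 * (-1) ^+ p.2) (fun p => e p.1 \o lift p.2).
rewrite -(pair_big P xpredT (fun i (q : 'I_k.+1) => c i * (-1) ^+ q * x' (e i \o lift q))) /=.
move=> H; rewrite -[RHS]H //.
- apply: eq_bigr => i Pi; rewrite xE; last exact: eA.
  by rewrite mulr_sumr; apply: eq_bigr => q _; rewrite mulrA.
- split; first exact: alternating_cons_fun.
    move=> J JA mJ; apply: mx; first exact: cnsA.
    by rewrite minor_cons_unit.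
  move=> m J mA JA; rewrite z'E -minor_cons_fun => mmJ.
  have xmJ : x (cons_fun m J) = 0 by apply: mx => //; apply: cnsA.
  have := dx0 m (cons_fun j0 J) mA (cnsA _ j0 J j0A JA).
  by rewrite delta_cons_fun xmJ subr0.
- by move=> p; rewrite andbT => Pp q /=; apply: eA.
(* A point t of the restricted arrangement is the point (1, t) of the cone. *)
move=> t tA.
rewrite -(pair_big P xpredT (fun i (q : 'I_k.+1) => c i * (-1) ^+ q * (minor b' (e i \o lift q)
   / \prod_l f b' ((e i \o lift q) l) z' t))) /=.
pose u := \row_i cons_fun 1 (t 0) i.
have fu j : f b j 0 u = f b' j z' t.
  rewrite f0E /g big_ord_recl mxE cons_fun0 mulr1 /f !mxE; congr (_ + _).
  by apply: eq_bigr => i _; rewrite !mxE cons_funS.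
have fj0 : f b j0 0 u = 1.
  rewrite fu /f !mxE /g big1 ?addr0 => [|i _].
    by have := congr1 (fun v : 'rV_k.+1 => v 0 ord0) bj0; rewrite !mxE eqxx.
  have := congr1 (fun v : 'rV_k.+1 => v 0 (lift ord0 i)) bj0.
  by rewrite !mxE => ->; rewrite andbF mul0r.
rewrite -[RHS](hyp u); last by move=> j jA; rewrite fu tA.
apply: eq_bigr => i Pi; under eq_bigr => q _ do rewrite -mulrA.
rewrite -mulr_sumr; congr (_ * _).
have fn0 q : f b (e i q) 0 u != 0 by rewrite fu tA // eA.
have minorE : minor b (e i) = \sum_q f b (e i q) 0 u * minor b (upd (e i) q j0).
  have := fundrel_f b 0 u j0 (e i); rewrite fundrel0 /fundrel fj0 mul1r => /eqP.
  by rewrite subr_eq0 => /eqP.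
rewrite minorE mulr_suml; apply: eq_bigr => q _.
rewrite upd_alternating_cons; last exact: alternating_minor.
rewrite minor_cons_unit // (bigD1_ord q) //= invfM.
under [X in _ = _ * (_ / X)]eq_bigr => l _ do rewrite fu.
by rewrite [RHS]mulrACA mulfV // mul1r mulrA.
Qed.

(** Any nonzero g_j with j in A can be taken as the first coordinate; if there is
    none, all minors vanish and so does x. *)
Lemma complete_central_succ {k} (b : 'M[C]_(n, k.+1)) A :
  (forall (b' : 'M[C]_(n, k)) z', complete b' z' A) -> complete b 0 A.
Proof.
move=> cb'; have [[j0 j0A bj0]|no_j] := pselect (exists2 j, j \in A & row j b != 0).
  have [Q uQ bQ] := row_to_delta _ bj0.
  apply: (complete_mulmx _ _ _ uQ); apply: (complete_decone _ _ _ j0A).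
    by rewrite row_mul.
  exact: cb'.
move=> x [ax mx dx] I P c e eA _; apply: big1 => i Pi; rewrite mx ?mulr0 //.
  exact: eA.
rewrite minor.unlock (expand_det_row _ ord0) big1 // => j _.
have /eqP : row (e i ord0) b == 0.
  by apply/negPn/negP => r0; apply: no_j; exists (e i ord0); rewrite ?eA.
by move/(congr1 (fun v : 'rV_k.+1 => v 0 j)); rewrite !mxE => ->; rewrite mul0r.
Qed.

(** Near a vertex p the function of a basis s is homogeneous of degree -k when
    all hyperplanes of s pass through p, and has a pole of lower order otherwise.
    Along p + e u, multiplication by e^k therefore isolates, at e = 0, the
    functions of the bases at p, which belong to a central arrangement. *)
Lemma complete_local {k} (b : 'M[C]_(n, k)) z A :
  (forall A', complete b 0 A') -> complete b z A.
Proof.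
move=> cb x [ax mx dx] I P c e eA hyp.
rewrite (bigID (fun i => minor b (e i) == 0)) /= big1 ?add0r; last first.
  by move=> i /andP[Pi /eqP mi]; rewrite mx ?mulr0 //; apply: eA.
have vertex i : exists p, minor b (e i) != 0 -> forall q, f b (e i q) z p = 0.
  pose S := rowsub (e i) b.
  exists (- (invmx S *m \col_q z 0 (e i q))^T) => ds q.
  have uS : S \in unitmx.
    by rewrite unitmxE unitfE; move: ds; rewrite minor.unlock.
  have -> : f b (e i q) z (- (invmx S *m \col_q z 0 (e i q))^T) =
      z 0 (e i q) - (S *m (invmx S *m \col_q z 0 (e i q))) q 0.
    rewrite /f gE; congr (_ + _); rewrite linearN /= trmxK mulmxN mxE; congr (- _).
    by rewrite !mxE; apply: eq_bigr => l _; rewrite [S q l]mxE.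
  by rewrite mulKVmx // mxE subrr.
have {vertex}[p pP] := choice vertex.
(* Bases are grouped by the hyperplanes through their vertex, which determine
   the vertex. *)
pose loc i : {set 'I_n} := [set j in A | f b j z (p i) == 0].
rewrite (partition_big loc xpredT) //=; apply: big1 => B _.
have [/existsP[i0 /andP[/andP[Pi0 mi0] /eqP locB]]|/existsPn noi] :=
  boolP [exists i, (P i && (minor b (e i) != 0)) && (loc i == B)]; last first.
  by rewrite big1 // => i Pi; have := noi i; rewrite Pi.
have BA j : j \in B -> j \in A by rewrite -locB inE => /andP[].
have Bf j : j \in B -> f b j z (p i0) = 0 by rewrite -locB inE => /andP[_ /eqP].
have locE i : P i && (minor b (e i) != 0) ->
    (loc i == B) = [forall q, e i q \in B].
  move=> /andP[Pi mi]; apply/idP/forallP => [/eqP <- q|eB].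
    by rewrite inE eA // pP // eqxx.
  suff pE : p i = p i0 by rewrite -locB /loc pE.
  have uS : rowsub (e i) b \in unitmx.
    by rewrite unitmxE unitfE; move: mi; rewrite minor.unlock.
  apply: trmx_inj; apply: (can_inj (mulKmx uS)); apply/colP => q.
  have E t : (rowsub (e i) b *m t^T) q 0 = f b (e i q) z t - z 0 (e i q).
    rewrite /f gE addrC addKr !mxE; apply: eq_bigr => l _.
    by rewrite [rowsub _ _ _ _]mxE.
  by rewrite !E pP // Bf.
apply: (cb B x); first split=> //.
- by move=> s sB; apply: mx => q; apply: BA.
- move=> m s mB sB _; apply: dx => [|q|]; [exact: BA|exact/BA|].
  rewrite -(fundrel_f b z (p i0)) /fundrel Bf // mul0r big1 ?subr0 // => q _.
  by rewrite Bf // mul0r.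
- by move=> i /andP[Pi]; rewrite locE // => /forallP.
move=> u uB.
have fe j e1 : f b j z (p i0 + e1 *: u) = f b j z (p i0) + e1 * f b j 0 u.
  rewrite f0E /f !gE linearD linearZ /= mulmxDr -scalemxAr.
  by rewrite [X in _ + X]mxE [X in _ + (_ + X)]mxE addrA.
pose R (Q : pred 'I_n) e1 := \prod_(j in A :\: B | Q j) f b j z (p i0 + e1 *: u).
have polyf j : polyfun (fun e1 => f b j z (p i0 + e1 *: u)).
  have [q qE] := polyfunD _ _ (polyfun_cst (f b j z (p i0)))
    (polyfunM _ _ polyfun_id (polyfun_cst (f b j 0 u))).
  by exists q => e1; rewrite fe qE.
have polyR Q : polyfun (R Q) by apply: polyfun_prod => j _; apply: polyf.
(* e R / f at p + e u, written as a polynomial in e. *)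
pose T i q e1 := if e i q \in B then R xpredT e1 / f b (e i q) 0 u
   else e1 * R (predC1 (e i q)) e1.
have polyT i q : polyfun (T i q).
  rewrite /T; case: (e i q \in B); apply: polyfunM => //; first exact: polyfun_cst.
  exact: polyfun_id.
pose h e1 := \sum_(i | P i && (minor b (e i) != 0))
   c i * (minor b (e i) * \prod_q T i q e1).
have polyh : polyfun h.
  apply: polyfun_sum => i _; apply: polyfunM; first exact: polyfun_cst.
  apply: polyfunM; first exact: polyfun_cst.
  exact: polyfun_prod.
have R0 : R xpredT 0 != 0.
  rewrite /R; apply/prodf_neq0 => j; rewrite andbT inE => /andP[jB jA].
  by rewrite scale0r addr0; apply: contraNN jB; rewrite -locB inE jA.
have h0 : h 0 = 0.
  apply: (polyfun_limit _ _ polyh (polyR xpredT) R0) => e1 e0 Re.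
  have tA j : j \in A -> f b j z (p i0 + e1 *: u) != 0.
    move=> jA; have [jB|jB] := boolP (j \in B).
      by rewrite fe Bf // add0r mulf_neq0 // uB.
    have /prodf_neq0/(_ j) := Re.
    by rewrite inE jA jB; apply.
  rewrite -[RHS](mulr0 ((e1 * R xpredT e1) ^+ k)).
  rewrite -[X in _ = _ * X](hyp _ tA) [in RHS](bigID (fun i => minor b (e i) == 0)) /=.
  rewrite [X in _ = _ * (X + _)]big1 ?add0r; last first.
    by move=> i /andP[_ /eqP->]; rewrite mul0r mulr0.
  rewrite mulr_sumr; apply: eq_bigr => i /andP[Pi mi].
  rewrite [RHS]mulrCA [X in _ = _ * X]mulrCA; congr (_ * (_ * _)).
  rewrite -[X in _ ^+ X](card_ord k) -prodr_const -prodfV -big_split /=.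
  apply: eq_bigr => q _; rewrite /T; case: ifP => [qB|/negbT qB].
    by rewrite fe Bf // add0r invfM mulrACA mulfV // mul1r.
  rewrite -mulrA; congr (_ * _).
  rewrite {2}/R (bigD1 (e i q)) /=; last by rewrite inE qB eA.
  rewrite mulrAC mulfV ?mul1r; last by apply: tA; apply: eA.
  by apply: eq_bigl => j; rewrite andbT.
have Rk : R xpredT 0 ^+ k != 0 by rewrite expf_neq0.
apply: (mulfI Rk); rewrite mulr0 -[RHS]h0 /h.
rewrite [RHS](bigID (fun i => loc i == B)) /= [X in _ = _ + X]big1 ?addr0.
  rewrite mulr_sumr; apply: eq_bigr => i /andP[Pi]; rewrite locE // => /forallP eB.
  rewrite [LHS]mulrCA [X in _ * X = _]mulrCA; congr (_ * (_ * _)).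
  rewrite -[X in _ ^+ X](card_ord k) -prodr_const -prodfV -big_split /=.
  by apply: eq_bigr => q _; rewrite /T eB.
move=> i /andP[Pi]; rewrite locE // => /forallPn[q qB].
by rewrite (bigD1 q) //= /T (negbTE qB) !mul0r !mulr0.
Qed.

Theorem completeness {k} (b : 'M[C]_(n, k)) z A : complete b z A.
Proof.
elim: k b z A => [|k IH] b z A; apply: complete_local => A'.
  exact: complete_dim0.
by apply: complete_central_succ => b' z'; apply: IH.
Qed.
End Completeness.

(** * The space V as a space of alternating functions *)

HB.lock Definition ext {C : numClosedFieldType} {n k : nat} {b : 'M[C]_(n, k)}
    (x : V b) (s : 'I_k -> 'I_n) : C :=
  \sum_I x I * F b [tuple s i | i < k] I.

Section Ext.
Context {C : numClosedFieldType} {n k : nat} {b : 'M[C]_(n, k)}.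
Implicit Types (x : V b) (s : 'I_k -> 'I_n) (I : indep_tuple b).

Lemma free_relP (m : nat) (J : 'I_m -> 'I_n) :
  reflect (forall beta : 'I_m -> C, \sum_q beta q *: row (J q) b = 0 ->
             forall q, beta q = 0)
    (free [seq row j b | j <- [tuple J i | i < m]]).
Proof.
apply: (iffP (@freeP _ _ m (map_tuple (fun j => row j b) [tuple J i | i < m]))).
  move=> fr beta; rewrite (eq_bigr (fun i => beta i *:
      [seq row j b | j <- [tuple J i | i < m]]`_i)); first exact: fr.
  move=> i _; rewrite (nth_map (J i)) ?size_tuple //; congr (_ *: row _ b).
  by rewrite -tnth_nth tnth_mktuple.
move=> fr beta; rewrite (eq_bigr (fun i => beta i *: row (J i) b)); first exact: fr.
move=> i _; rewrite (nth_map (J i)) ?size_tuple //; congr (_ *: row _ b).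
by rewrite -tnth_nth tnth_mktuple.
Qed.

Lemma indep_minor s : indep b [tuple s i | i < k] = (minor b s != 0).
Proof.
apply/free_relP/idP => [fr|ms beta]; last exact: minor_free.
apply/eqP; rewrite minor.unlock => /eqP/det0P[v v0 vS].
move/eqP: v0; apply; apply/rowP => q; rewrite mxE; apply: (fr (v 0)).
rewrite -[RHS]vS; apply/rowP => j; rewrite summxE mxE.
by apply: eq_bigr => i _; rewrite !mxE.
Qed.

Lemma indep_uniqP (u : seq 'I_n) : uniq u ->
  (indep b u <-> forall mu : 'I_n -> C, \sum_(i <- u) mu i *: row i b = 0 ->
     forall i, i \in u -> mu i = 0).
Proof.
move=> uu; have -> : indep b u = free [seq row j b | j <- [tuple tnth (in_tuple u) i | i < size u]].
  rewrite /indep; congr (free (map _ _)).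
  by rewrite -[LHS]/(val (in_tuple u)); congr val; apply/eq_from_tnth => i; rewrite tnth_mktuple.
have bigE (F : 'I_n -> 'rV[C]_k) : \sum_(i <- u) F i = \sum_i F (tnth (in_tuple u) i).
  by rewrite -[in LHS](in_tupleE u) big_tuple.
split=> [/free_relP fr mu e i /(@tnthP _ _ (in_tuple u)) [l ->]|H].
  by apply: (fr (fun l => mu (tnth (in_tuple u) l))); rewrite -(bigE (fun i => mu i *: row i b)).
apply/free_relP => beta e q.
have u0 : 'I_n by have := tnth (in_tuple u) q.
pose mu i := if insub (index i u) is Some l then beta l else 0.
have muE l : mu (tnth (in_tuple u) l) = beta l.
  by rewrite /mu (tnth_nth u0) index_uniq // valK.
rewrite -muE; apply: H; last exact: mem_tnth.
by rewrite bigE -[RHS]e; apply: eq_bigr => l _; rewrite muE.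
Qed.

Lemma minor_subset_rel s (Y : {set 'I_n}) (mu : 'I_n -> C) :
  minor b s != 0 -> Y \subset [set s q | q : 'I_k] ->
  \sum_(i in Y) mu i *: row i b = 0 -> forall i, i \in Y -> mu i = 0.
Proof.
move=> ms Ys e i iY.
have YE : Y = s @: [set q | s q \in Y].
  apply/setP => j; apply/idP/imsetP => [jY|[q + ->]]; last by rewrite inE.
  have /imsetP[q _ jE] := fintype.subsetP Ys j jY.
  by exists q => //; rewrite inE -jE.
have si := minor_inj _ _ ms.
have := minor_free b s (fun q => if s q \in Y then mu (s q) else 0) ms.
move: e; rewrite {1}YE big_imset; last by move=> ? ? _ _ /si.
move=> e /(_ _) H; have /imsetP[q _ iE] := fintype.subsetP Ys i iY.
rewrite iE in iY *; rewrite -[RHS](H _ q) ?iY //=.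
rewrite -[RHS]e [RHS]big_mkcond /=; apply: eq_bigr => l _; rewrite inE.
by case: ifP => _; rewrite ?scale0r.
Qed.

Lemma tup_inj s s' : [tuple s i | i < k] = [tuple s' i | i < k] :> seq _ -> s = s'.
Proof.
move=> /val_inj e; apply/funext => i.
by have := congr1 (fun t => tnth t i) e; rewrite !tnth_mktuple.
Qed.

Lemma indep_tuple_minor I : minor b (tnth (val I)) != 0.
Proof.
rewrite -indep_minor; have /andP[_] := valP I; congr (indep b _).
by congr val; apply/eq_from_tnth => i; rewrite tnth_mktuple.
Qed.

Lemma indep_tuple_sorted I : sorted ltn (map val (val I)).
Proof. by have /andP[] := valP I. Qed.

Lemma sorted_tuple_inj (u v : seq 'I_n) : sorted ltn (map val u) ->
  sorted ltn (map val v) -> perm_eq u v -> u = v.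
Proof.
move=> su sv /(perm_map val) puv; apply: (inj_map val_inj).
by apply: (irr_sorted_eq ltn_trans ltnn) => // i; apply: perm_mem.
Qed.

Lemma F_neq0 (u : seq 'I_n) I : F b u I != 0 ->
  exists w : 'S_k, u = [tuple tnth (val I) (w l) | l < k].
Proof.
rewrite ffunE => F0; apply: contrapT => no_w; move/eqP: F0; apply.
apply: big1 => w _; case: eqP => [e|]; last by rewrite mulr0.
by case: no_w; exists w.
Qed.

Lemma F_perm_eq (u : seq 'I_n) I : F b u I != 0 -> perm_eq u (val I).
Proof.
by move/F_neq0 => [w ->]; apply/tuple_permP; exists w.
Qed.

Lemma F_perm I I' (w : 'S_k) :
  F b [tuple tnth (val I) (w l) | l < k] I' = (-1) ^+ w * (I' == I)%:R.
Proof.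
have [->|nI] := eqVneq I' I; last first.
  rewrite mulr0; apply/eqP; apply: contraTT nI => /F_perm_eq p; rewrite negbK.
  apply/eqP/val_inj/val_inj/sorted_tuple_inj; rewrite ?indep_tuple_sorted //.
  rewrite perm_sym; apply: perm_trans p; rewrite perm_sym.
  by apply/tuple_permP; exists w.
rewrite mulr1 ffunE (bigD1 w) //= eqxx mulr1 big1 ?addr0 // => w' nw.
case: eqP => [/tup_inj e|]; last by rewrite mulr0.
case/eqP: nw; apply/permP => i.
by have := congr1 (fun h => h i) e; move/(minor_inj _ _ (indep_tuple_minor I)).
Qed.

Lemma minor_cover s : minor b s != 0 ->
  exists I, exists w : 'S_k, s = tnth (val I) \o w.
Proof.
move=> ms; pose u := sort (fun i j : 'I_n => i <= j)%N [tuple s i | i < k].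
have pu : perm_eq u [tuple s i | i < k] by rewrite perm_sort.
have su : size u = k by rewrite size_sort size_tuple.
have sort_u : sorted ltn (map val u).
  rewrite ltn_sorted_uniq_leq map_inj_uniq ?sort_uniq; last exact: val_inj.
  rewrite map_inj_uniq ?enum_uniq; last exact: minor_inj ms.
  rewrite sorted_map /= /u; apply: sort_sorted => i j; exact: leq_total.
have su' : size u == k by rewrite su.
have iu : sorted ltn (map val (Tuple su')) && indep b (Tuple su').
  by rewrite sort_u /indep (perm_free (perm_map _ pu)) -/(indep _ _) indep_minor.
have /tuple_permP[w we] : perm_eq [tuple s i | i < k] (Tuple su').
  by rewrite perm_sym.
exists (exist _ (Tuple su') iu), w; apply: tup_inj; rewrite we.
by congr val; apply: eq_from_tnth => i; rewrite !tnth_mktuple.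
Qed.

Lemma ext_perm x I (w : 'S_k) : ext x (tnth (val I) \o w) = (-1) ^+ w * x I.
Proof.
rewrite ext.unlock (bigD1 I) //= F_perm eqxx mulr1 big1 ?addr0 1?mulrC // => I' nI.
by rewrite F_perm (negbTE nI) !mulr0.
Qed.

Lemma ext_tnth x I : ext x (tnth (val I)) = x I.
Proof.
rewrite -[RHS]mul1r -[1](expr0 (-1)) -[0%N]/(nat_of_bool false) -(@odd_perm1 'I_k).
by rewrite -ext_perm; congr ext; apply/funext => i /=; rewrite perm1.
Qed.

Lemma ext_eq0 x s : minor b s = 0 -> ext x s = 0.
Proof.
move=> ms; rewrite ext.unlock; apply: big1 => I _.
have [->|/F_neq0[w /tup_inj e]] := eqVneq (F b [tuple s i | i < k] I) 0.
  by rewrite mulr0.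
have := indep_tuple_minor I; have := alternating_minor b (tnth (val I)) w.
rewrite (_ : _ \o w = s) ?ms; last by rewrite e.
by move/eqP; rewrite eq_sym mulf_eq0 signr_eq0 /= => ->.
Qed.

Lemma alternating_ext x : alternating (ext x).
Proof.
move=> s w; have [ms|/minor_cover[I [w' ->]]] := eqVneq (minor b s) 0.
  by rewrite !ext_eq0 ?mulr0 // alternating_minor ms mulr0.
have -> : (tnth (val I) \o w') \o w = tnth (val I) \o (w * w')%g.
  by apply/funext => i; rewrite /= permM.
by rewrite !ext_perm odd_permM signr_addb mulrA.
Qed.

(** Tuples with nonzero minor are the rearrangements of the increasing ones, so
    an alternating function is known from its values on the basis of V. *)
Lemma ext_uniq x (y : ('I_k -> 'I_n) -> C) : alternating y ->
  (forall s, minor b s = 0 -> y s = 0) ->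
  (forall I, y (tnth (val I)) = x I) -> ext x = y.
Proof.
move=> ay y0 yx; apply/funext => s.
have [ms|/minor_cover[I [w ->]]] := eqVneq (minor b s) 0.
  by rewrite ext_eq0 // y0.
by rewrite ext_perm ay yx.
Qed.

Lemma ext_inj : injective (@ext C n k b).
Proof. by move=> x y e; apply/ffunP => I; rewrite -!ext_tnth e. Qed.

Lemma ext_lin (c : C) x y s : ext (c *: x + y) s = c * ext x s + ext y s.
Proof.
rewrite ext.unlock mulr_sumr -big_split; apply: eq_bigr => I _.
by rewrite !ffunE mulrDl mulrA.
Qed.

Lemma extZ (c : C) x s : ext (c *: x) s = c * ext x s.
Proof. by rewrite ext.unlock mulr_sumr; apply: eq_bigr => I _; rewrite !ffunE mulrA. Qed.

End Ext.

(** * The operators L_C in coordinates *)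

Section LFormula.
Context {C : numClosedFieldType} {n k : nat} {b : 'M[C]_(n, k)}.
Context (a : 'I_n -> C).
Implicit Types (x : V b) (s : 'I_k -> 'I_n) (I : indep_tuple b) (X : {set 'I_n}).

Lemma scale_ffunE (c : C) (v : V b) I : (c *: v) I = c * v I.
Proof. by rewrite ffunE. Qed.

Definition entries s : {set 'I_n} := [set s q | q : 'I_k].

Lemma mem_entries_tuple (J : k.-tuple 'I_n) i : (i \in entries (tnth J)) = (i \in J).
Proof.
apply/imsetP/tnthP => [[q _ ->]|[q ->]]; first by exists q.
by exists q.
Qed.

Lemma circuit_not_sub X s : circuit b X -> minor b s != 0 -> ~~ (X \subset entries s).
Proof.
move=> /andP[nX _] ms; apply: contra nX => Xs.
have := indep_uniqP (b := b) (enum X) (enum_uniq _) => -[_]; apply => mu e i.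
rewrite mem_enum; apply: (minor_subset_rel _ _ _ ms Xs).
by rewrite -[RHS]e big_enum.
Qed.

Lemma sorted_off X I : sorted ltn (map val [seq j <- val I | j \notin X]).
Proof.
have -> : map val [seq j <- val I | j \notin X] =
    [seq i <- map val (val I) | i \notin map val (enum X)].
  rewrite filter_map; congr map; apply: eq_filter => j /=.
  by rewrite mem_map ?mem_enum //; apply: val_inj.
by apply: sorted_filter; [exact: ltn_trans|exact: indep_tuple_sorted].
Qed.

Lemma F_off X m (S : seq 'I_n) I : all [pred j | j \notin X] S ->
  sorted ltn (map val S) -> F b (rem m (enum X) ++ S) I != 0 ->
  [seq j <- val I | j \notin X] = S.
Proof.
move=> SX sS /F_perm_eq p; apply: sorted_tuple_inj => //; first exact: sorted_off.
rewrite perm_sym; have := perm_filter [pred j | j \notin X] p.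
rewrite filter_cat (eqP (_ : filter _ (rem _ _) == [::])) ?(all_filterP SX) //.
rewrite -(negbK (_ == _)) -has_filter -all_predC; apply/allP => j /mem_rem.
by rewrite mem_enum /= negbK.
Qed.

(** When F(rem m X, S) has a component along I, the part of I outside X is S, m is
    the only element of X missing from I, and the case distinction in the
    definition of L_C becomes automatic.  This frees the coordinates of L_C F(I)
    from the order of the entries of I. *)
Lemma L_basisE X I I' (S := [seq j <- val I' | j \notin X]) :
  L_basis a X I I' =
  \sum_(m in X) \sum_(l in X) F b (rem m (enum X) ++ S) I * (-1) ^+ index m (enum X) *
     ((-1) ^+ index l (enum X) * a l * F b (rem l (enum X) ++ S) I').
Proof.
have filt (J : indep_tuple b) : all [pred j | j \notin X] [seq j <- val J | j \notin X].
  by apply: filter_all.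
have FI m : m \in X -> F b (rem m (enum X) ++ S) I != 0 ->
    m \notin val I /\ (#|[pred j in X | j \in val I]| < #|X|.-1)%N = false.
  move=> mX /F_perm_eq/perm_mem p; have mI j : j \in X -> (j \in val I) = (j != m).
    move=> jX; rewrite -p mem_cat mem_filter jX /= orbF mem_rem_uniq ?enum_uniq //.
    by rewrite inE /= mem_enum jX andbT.
  split; first by rewrite mI // eqxx.
  apply/negbTE; rewrite -leqNgt (cardsD1 m X) mX /=; apply: subset_leq_card.
  by apply/fintype.subsetP => j; rewrite !inE => /andP[jm jX]; rewrite jX mI.
rewrite /L_basis; set SI := [seq j <- val I | j \notin X].
have [e|ne] := eqVneq SI S; last first.
  rewrite [RHS]big1 => [|m mX].
    case: ifP => _; first by rewrite ffunE.
    rewrite sum_ffunE big1 // => m _; rewrite scale_ffunE sum_ffunE big1 ?mulr0 //.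
    move=> l lX; rewrite scale_ffunE; case: (eqVneq (F b (rem l (enum X) ++ SI) I') 0).
      by move=> ->; rewrite mulr0.
    move/(F_off _ _ _ _ (filt _) (sorted_off _ _)) => E.
    by case/eqP: ne; exact: (esym E).
  rewrite big1 // => l _.
  case: (eqVneq (F b (rem m (enum X) ++ S) I) 0) => [->|]; first by rewrite !mul0r.
  by move/(F_off _ _ _ _ (filt _) (sorted_off _ _)) => E; case/eqP: ne.
rewrite e; case: ifP => cond.
  rewrite ffunE big1 // => m mX; rewrite big1 // => l _.
  case: (eqVneq (F b (rem m (enum X) ++ S) I) 0) => [->|]; first by rewrite !mul0r.
  by case/(FI m mX) => _; rewrite cond.
rewrite sum_ffunE big_mkcondr; apply: eq_bigr => m mX; case: ifP => mI.
  rewrite scale_ffunE sum_ffunE [LHS]mulr_sumr; apply: eq_bigr => l _.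
  by rewrite scale_ffunE.
rewrite big1 // => l _.
case: (eqVneq (F b (rem m (enum X) ++ S) I) 0) => [->|]; first by rewrite !mul0r.
by case/(FI m mX); rewrite mI.
Qed.

Lemma tuple_face (u : seq 'I_n) (d : 'I_n) (i : 'I_k.+1) : size u = k.+1 ->
  [tuple ((fun j : 'I_k.+1 => nth d u j) \o lift i) j | j < k] =
    take i u ++ drop i.+1 u :> seq _.
Proof.
move=> su; have ik : (i <= k)%N by rewrite -ltnS.
have szt : size (take i u) = i by rewrite size_takel // su ltnW.
apply: (@eq_from_nth _ d).
  by rewrite size_tuple size_cat szt size_drop su subSS subnKC.
rewrite size_tuple => j jk.
rewrite -[j]/(nat_of_ord (Ordinal jk)) -tnth_nth tnth_mktuple /=.
rewrite nth_cat szt /bump; case: (ltnP j i) => ji; first by rewrite nth_take.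
by rewrite nth_drop addSn subnKC.
Qed.

(** The sum over m in the definition of L_C is the boundary of x on the list
    (X, S); its faces which contain all of X do not contribute, because X is
    dependent.  Boundary and basis vector change by the same sign when (X, S) is
    reordered to (l, I), which removes all signs. *)
Lemma L_coord X x I : circuit b X ->
  L a X x I = \sum_(m | X \subset m |: entries (tnth (val I)))
     a m * delta (ext x) m (tnth (val I)).
Proof.
move=> cX; pose S := [seq j <- val I | j \notin X].
pose ex (u : seq 'I_n) := \sum_J x J * F b u J.
transitivity (\sum_(l in X) a l * ((-1) ^+ index l (enum X) *
   F b (rem l (enum X) ++ S) I *
   \sum_(m in X) (-1) ^+ index m (enum X) * ex (rem m (enum X) ++ S))).
  rewrite /L sum_ffunE.
  under eq_bigr => J _ do rewrite scale_ffunE L_basisE -/S mulr_sumr.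
  rewrite exchange_big /=; under eq_bigr => m _.
    under eq_bigr => J _ do rewrite mulr_sumr.
    rewrite exchange_big /=; over.
  rewrite exchange_big /=; apply: eq_bigr => l _.
  rewrite mulr_sumr mulr_sumr; apply: eq_bigr => m _.
  rewrite /ex !mulr_sumr; apply: eq_bigr => J _; ring.
have subX m : X \subset m |: entries (tnth (val I)) -> m \in X.
  move=> Xm; apply: contraNT (circuit_not_sub _ _ cX (indep_tuple_minor I)) => mX.
  apply/fintype.subsetP => j jX; have /fintype.subsetP/(_ j jX) := Xm.
  by rewrite in_setU1 => /orP[/eqP e|//]; move: mX; rewrite -e jX.
rewrite (bigID (fun l => X \subset l |: entries (tnth (val I)))) /= [X in _ + X]big1 ?addr0.
  apply: eq_big => [l|l /andP[lX Xl]].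
    by apply/andP/idP => [[]|Xl] //; split => //; apply: subX.
  congr (_ * _).
  have memS j : (j \in S) = (j \in val I) && (j \notin X).
    by rewrite mem_filter andbC.
  have lI : l \notin val I.
    apply: contraNN (circuit_not_sub _ _ cX (indep_tuple_minor I)) => lI.
    by move: Xl; rewrite (finset.setUidPr _) // finset.sub1set mem_entries_tuple.
  have p : perm_eq (rem l (enum X) ++ S) (val I).
    have uI : uniq (val I).
      by apply: (map_uniq (f := val)); apply: sorted_uniq (indep_tuple_sorted I);
        [exact: ltn_trans|exact: ltnn].
    apply: uniq_perm => //.
      rewrite cat_uniq rem_uniq ?enum_uniq // filter_uniq // andbT.
      by apply/hasPn => j; rewrite memS => /andP[_]; apply: contra => /mem_rem; rewrite mem_enum.
    move=> j; rewrite mem_cat memS mem_rem_uniq ?enum_uniq // inE /= mem_enum.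
    have [jX|] := boolP (j \in X); last by rewrite andbF andbT.
    rewrite andbT andbF orbF; have /fintype.subsetP/(_ j jX) := Xl.
    rewrite in_setU1 mem_entries_tuple; have [->|//] := eqVneq j l.
    by rewrite (negbTE lI).
  have /tuple_permP[w we] := p.
  pose u := enum X ++ S.
  have su : size u = k.+1.
    have := perm_size p; rewrite size_tuple /u !size_cat size_rem ?mem_enum // => <-.
    by rewrite -addSn prednK // lt0n size_eq0; apply/eqP => e; move: lX; rewrite -mem_enum e.
  pose U (i : 'I_k.+1) := nth l u i.
  have sX : (size (enum X) <= k.+1)%N by rewrite -su size_cat leq_addr.
  have ip : (index l (enum X) < k.+1)%N.
    by apply: leq_trans sX; rewrite index_mem mem_enum.
  have exface (i : 'I_k.+1) : ex (take i u ++ drop i.+1 u) = ext x (U \o lift i).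
    by rewrite ext.unlock -(tuple_face u l).
  have remu i : (i < size (enum X))%N ->
      rem (nth l (enum X) i) (enum X) ++ S = take i u ++ drop i.+1 u.
    move=> iX; rewrite remE index_uniq ?enum_uniq // /u take_cat iX drop_cat -catA.
    congr (_ ++ _); case: ltnP => // Xi; rewrite drop_oversize //=.
    by rewrite (eqP (_ : i.+1 - size (enum X) == 0)%N) ?drop0 // subn_eq0.
  have -> : \sum_(m in X) (-1) ^+ index m (enum X) * ex (rem m (enum X) ++ S) =
      \sum_(i < k.+1) (-1) ^+ i * ext x (U \o lift i).
    under [RHS]eq_bigr => i _ do rewrite -exface.
    rewrite -(big_mkord xpredT (fun i => (-1) ^+ i * ex (take i u ++ drop i.+1 u))).
    rewrite (@big_cat_nat _ _ _ (size (enum X))) //= [X in _ = _ + X]big_nat_cond.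
    rewrite [X in _ = _ + X]big1 ?addr0.
      rewrite -big_enum /= (big_nth l) big_nat_cond [RHS]big_nat_cond.
      apply: eq_bigr => i /andP[/andP[_ iX] _].
      by rewrite index_uniq ?enum_uniq // remu.
    move=> i; rewrite andbT => /andP[Xi ik].
    have := exface (Ordinal ik) => /= ->; rewrite ext_eq0 ?mulr0 //.
    apply/eqP; apply: contraTT isT => /(circuit_not_sub _ _ cX)/negP[].
    apply/fintype.subsetP => j jX.
    have : j \in take i u ++ drop i.+1 u.
      by rewrite mem_cat /u take_cat ltnNge Xi /= mem_cat mem_enum jX.
    rewrite -(tuple_face u l (Ordinal ik) su) => /tnthP[q ->].
    by rewrite tnth_mktuple; apply/imsetP; exists q.
  rewrite (delta_faces _ U (Ordinal ip)) ?alternating_ext //=; last exact: alternating_ext.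
  have Ul : U (Ordinal ip) = l.
    by rewrite /U /= /u nth_cat index_mem mem_enum lX nth_index // mem_enum.
  have -> : U \o lift (Ordinal ip) = tnth (val I) \o w.
    apply: tup_inj; rewrite (tuple_face u l) //= -we -remu ?index_mem ?mem_enum //.
    by rewrite nth_index ?mem_enum.
  rewrite Ul we F_perm eqxx mulr1 delta_perm; last exact: alternating_ext.
  by rewrite mulrACA -expr2 sqrr_sign mul1r mulrA -expr2 sqrr_sign mul1r.
move=> l /andP[lX Xl].
have [->|/F_perm_eq/perm_mem p] := eqVneq (F b (rem l (enum X) ++ S) I) 0.
  by rewrite mulr0 mul0r mulr0.
case/negP: Xl; apply/fintype.subsetP => j jX; rewrite in_setU1 mem_entries_tuple -p mem_cat.
have [//|jl] := eqVneq j l.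
by rewrite mem_rem_uniq ?enum_uniq // inE /= jl mem_enum jX.
Qed.

End LFormula.

(** * The circuit inside k + 1 spanning covectors *)

Section Circuits.
Context {C : numClosedFieldType} {n k : nat} {b : 'M[C]_(n, k)}.
Implicit Types (s : 'I_k -> 'I_n) (X : {set 'I_n}) (m p : 'I_n).

Definition delta_fun (i : 'I_n) : 'I_n -> C := fun j => (j == i)%:R.

Lemma fundrel_expand y m s : fundrel b y m s = \sum_i fundrel b (delta_fun i) m s * y i.
Proof.
have E j : y j = \sum_i delta_fun i j * y i.
  rewrite (bigD1 j) //= /delta_fun eqxx mul1r big1 ?addr0 // => i ni.
  by rewrite eq_sym (negbTE ni) mul0r.
have -> : fundrel b y m s = \sum_i delta_fun i m * y i * minor b s
    - \sum_i \sum_q delta_fun i (s q) * y i * minor b (upd s q m).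
  rewrite /fundrel {1}(E m) mulr_suml exchange_big /=; congr (_ - _).
  by apply: eq_bigr => q _; rewrite {1}(E (s q)) mulr_suml.
rewrite -sumrB; apply: eq_bigr => i _.
rewrite mulrBl mulr_suml; congr (_ - _); first by rewrite mulrAC.
by apply: eq_bigr => q _; rewrite mulrAC.
Qed.

Lemma fundrel_new m s : m \notin entries s -> fundrel b (delta_fun m) m s = minor b s.
Proof.
move=> ms; rewrite /fundrel /delta_fun eqxx mul1r big1 ?subr0 // => q _.
case: eqP => [e|]; last by rewrite mul0r.
by case/negP: ms; apply/imsetP; exists q.
Qed.

Lemma fundrel_old m s q : minor b s != 0 -> m != s q ->
  fundrel b (delta_fun (s q)) m s = - minor b (upd s q m).
Proof.
move=> ds ms; rewrite /fundrel /delta_fun (negbTE ms) mul0r sub0r; congr (- _).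
rewrite (bigD1 q) //= eqxx mul1r big1 ?addr0 // => q' nq.
by rewrite (inj_eq (minor_inj _ _ ds)) (negbTE nq) mul0r.
Qed.

Lemma fundrel_off m s i : i \notin m |: entries s -> fundrel b (delta_fun i) m s = 0.
Proof.
rewrite in_setU1 => /norP[im is_]; rewrite /fundrel /delta_fun eq_sym (negbTE im) mul0r.
rewrite big1 ?subr0 // => q _; case: eqP => [e|]; last by rewrite mul0r.
by case/negP: is_; apply/imsetP; exists q.
Qed.

Context {lambda : {set 'I_n} -> 'I_n -> C} (lambdaP : circuit_relations b lambda).

(** The relations on {m} u s form a line when the g_(s_q) are a basis. *)
Lemma circuit_fundrel X m s : minor b s != 0 -> circuit b X -> X \subset m |: entries s ->
  exists2 c, c != 0 & forall i, lambda X i = c * fundrel b (delta_fun i) m s.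
Proof.
move=> ds cX Xms; have [[i0 i0X li0] l0 lrel] := lambdaP X cX.
have ms : m \notin entries s.
  apply: contraNN (circuit_not_sub _ _ cX ds) => ms.
  by move: Xms; rewrite (finset.setUidPr _) // finset.sub1set.
have si := minor_inj _ _ ds.
have rel : lambda X m *: row m b + \sum_q lambda X (s q) *: row (s q) b = 0.
  rewrite -[RHS]lrel [RHS]big_mkcond /= [RHS](bigID (mem (m |: entries s))) /=.
  rewrite [X in _ = _ + X]big1 ?addr0.
    rewrite big_setU1 // big_imset /=; last by move=> ? ? _ _ /si.
    have E i : (if i \in X then lambda X i *: row i b else 0) = lambda X i *: row i b.
      by case: ifP => // /negbT iX; rewrite l0 // scale0r.
    by rewrite E; congr (_ + _); apply: eq_big => [q|q _]; rewrite ?inE ?E.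
  move=> i ims; case: ifP => // iX.
  by case/negP: ims; apply: (fintype.subsetP Xms).
have lq q : minor b s * lambda X (s q) = - (lambda X m * minor b (upd s q m)).
  apply/eqP; rewrite -addr_eq0 addrC; apply/eqP.
  apply: (minor_free b s (fun q => lambda X m * minor b (upd s q m)
            + minor b s * lambda X (s q)) ds _ q).
  under eq_bigr => i _ do rewrite scalerDl -!scalerA.
  by rewrite big_split /= -!scaler_sumr cramer !scalerA mulrC -!scalerA -scalerDr
     rel scaler0.
have lE i : lambda X i = lambda X m / minor b s * fundrel b (delta_fun i) m s.
  have [|ioff] := boolP (i \in m |: entries s); last first.
    rewrite fundrel_off // mulr0 l0 //; apply: contraNN ioff.
    exact: (fintype.subsetP Xms).
  rewrite in_setU1 => /orP[/eqP ->|/imsetP[q _ ->]].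
    by rewrite fundrel_new // divfK.
  rewrite fundrel_old //; last first.
    by apply: contraNneq ms => ->; apply/imsetP; exists q.
  by apply: (mulfI ds); rewrite lq !mulrN mulrA [_ * (_ / _)]mulrC divfK.
exists (lambda X m / minor b s) => //.
by apply: contraNneq li0 => c0; rewrite lE c0 mul0r.
Qed.

Lemma circuit_support X i : circuit b X -> i \in X -> lambda X i != 0.
Proof.
move=> cX iX; have [[i0 i0X li0] l0 lrel] := lambdaP X cX.
apply: contraNneq li0 => li.
have [<-|ni] := eqVneq i i0; first by rewrite li.
have /andP[_ /forallP/(_ (X :\ i))] := cX.
rewrite finset.properD1 //= => /(indep_uniqP _ (enum_uniq _))/(_ (lambda X)) H.
rewrite H ?mem_enum ?inE 1?eq_sym ?ni //.
by rewrite big_enum /= -[RHS]lrel [RHS](big_setD1 i) //= li scale0r add0r.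
Qed.

Definition fund_circuit m s : {set 'I_n} := [set i | fundrel b (delta_fun i) m s != 0].

Lemma circuit_unique X m s : minor b s != 0 -> circuit b X ->
  X \subset m |: entries s -> X = fund_circuit m s.
Proof.
move=> ds cX Xms; have [c c0 lE] := circuit_fundrel _ _ _ ds cX Xms.
have [_ l0 _] := lambdaP X cX.
apply/setP => i; rewrite inE; apply/idP/idP => [iX|].
  by have := circuit_support _ _ cX iX; rewrite lE mulf_eq0 (negbTE c0).
by apply: contraNT => iX; have := l0 i iX; rewrite lE => /eqP; rewrite mulf_eq0 (negbTE c0).
Qed.

Lemma fund_circuitP m s : minor b s != 0 -> m \notin entries s ->
  circuit b (fund_circuit m s) /\ fund_circuit m s \subset m |: entries s.
Proof.
move=> ds ms.
have dep : ~~ indep b (enum (m |: entries s)).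
  apply/negP => /(indep_uniqP _ (enum_uniq _))/(_ (fun i => fundrel b (delta_fun i) m s)) H.
  have := H _ m; rewrite mem_enum setU11 fundrel_new // => E.
  move: ds; rewrite E ?eqxx // big_enum /=.
  transitivity (\sum_i fundrel b (delta_fun i) m s *: row i b).
    rewrite [RHS](bigID (mem (m |: entries s))) /= [X in _ = _ + X]big1 ?addr0 // => i ni.
    by rewrite fundrel_off // scale0r.
  apply/rowP => j; rewrite summxE [RHS]mxE -[RHS](fundrel_col b j m s) [RHS]fundrel_expand.
  by apply: eq_bigr => i _; rewrite !mxE.
have [X /minsetP[nX minX] Xms] := minset_exists (P := fun Y => ~~ indep b (enum Y)) dep.
have cX : circuit b X.
  apply/andP; split=> //; apply/forallP => Y; apply/implyP => YX; apply/negPn/negP => nY.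
  by move: (YX); rewrite (minX Y nY (fintype.proper_sub YX)) fintype.properxx.
by rewrite -(circuit_unique X m s ds cX Xms).
Qed.

(** The value of c at the circuit contained in {m} u s.  As a sum over circuits
    it manifestly depends on the set {m} u s only. *)
Definition circuit_coef (c : {set 'I_n} -> C) m s : C :=
  \sum_(X : {set 'I_n} | circuit b X && (X \subset m |: entries s)) c X.

Lemma circuit_coef_fund c m s : minor b s != 0 -> m \notin entries s ->
  circuit_coef c m s = c (fund_circuit m s).
Proof.
move=> ds ms; have [cC Csub] := fund_circuitP m s ds ms.
rewrite /circuit_coef (bigD1 (fund_circuit m s)) /= ?cC // big1 ?addr0 // => X /andP[/andP[cX Xms]].
by rewrite (circuit_unique X m s ds cX Xms) eqxx.
Qed.

Lemma circuit_coef_mem c m s : minor b s != 0 -> m \in entries s -> circuit_coef c m s = 0.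
Proof.
move=> ds ms; apply: big1 => X /andP[cX].
by rewrite (finset.setUidPr _) ?finset.sub1set // (negbTE (circuit_not_sub _ _ cX ds)).
Qed.

Lemma fC_fundrel X m s (z : 'rV[C]_n) (c : C) :
  (forall i, lambda X i = c * fundrel b (delta_fun i) m s) ->
  fC lambda X z = c * fundrel b (z 0) m s.
Proof.
move=> lE; rewrite /fC fundrel_expand mulr_sumr; apply: eq_bigr => i _.
by rewrite lE mulrA.
Qed.

(** If m is an entry of s both sides vanish, the right-hand side by the
    convention 0 / 0 = 0. *)
Lemma circuit_coef_fundrel (z : 'rV[C]_n) j m s : minor b s != 0 ->
  circuit_coef (fun X => lambda X j / fC lambda X z) m s
  = fundrel b (delta_fun j) m s / fundrel b (z 0) m s.
Proof.
move=> ds; have [/imsetP[q _ ->]|ms] := boolP (m \in entries s).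
  by rewrite circuit_coef_mem // ?fundrel_mem ?mul0r //; apply/imsetP; exists q.
have [cC Csub] := fund_circuitP m s ds ms; rewrite circuit_coef_fund //.
have [c c0 lE] := circuit_fundrel _ _ _ ds cC Csub.
by rewrite (fC_fundrel _ _ _ _ _ lE) lE -mulf_div mulfV // mul1r.
Qed.

Lemma circuit_coef_exchange c m p s q : circuit_coef c p (upd s q m) = circuit_coef c m (upd s q p).
Proof.
have E m' p' : p' |: entries (upd s q m') \subset m' |: entries (upd s q p').
  apply/fintype.subsetP => i; rewrite !in_setU1 => /orP[/eqP ->|/imsetP[q' _ ->]].
    by apply/orP; right; apply/imsetP; exists q; rewrite ?upd_eq.
  rewrite {1}/upd; have [e|nq] := eqVneq q' q; first by rewrite /upd e !eqxx.
  by apply/orP; right; apply/imsetP; exists q'; rewrite // /upd (negbTE nq).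
rewrite /circuit_coef (_ : p |: _ = m |: entries (upd s q p)) //.
by apply/eqP; rewrite finset.eqEsubset !E.
Qed.

Lemma circuit_coef_perm c m s (w : 'S_k) : circuit_coef c m (s \o w) = circuit_coef c m s.
Proof.
rewrite /circuit_coef (_ : entries (s \o w) = entries s) //; apply/setP => i.
apply/imsetP/imsetP => -[q _ ->]; first by exists (w q).
by exists (w^-1%g q) => //=; rewrite permKV.
Qed.
End Circuits.

(** * Linear combinations of the operators L_C *)

Section Operators.
Context {C : numClosedFieldType} {n k : nat} {b : 'M[C]_(n, k)}.
Context (a : 'I_n -> C).
Implicit Types (s : 'I_k -> 'I_n) (X : {set 'I_n}) (m p : 'I_n) (x y : V b).
Implicit Types (c : {set 'I_n} -> C).

Definition circuit_op c x : V b := \sum_(X | circuit b X) c X *: L a X x.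

Lemma ext_circuit_op c x s : minor b s != 0 ->
  ext (circuit_op c x) s = \sum_m a m * circuit_coef (b := b) c m s * delta (ext x) m s.
Proof.
move=> ds.
pose y s' := if minor b s' == 0 then 0
             else \sum_m a m * circuit_coef (b := b) c m s' * delta (ext x) m s'.
rewrite (ext_uniq _ y) /y ?(negbTE ds) //.
- move=> s' w; rewrite alternating_minor mulf_eq0 signr_eq0 /=.
  case: ifP => _; first by rewrite mulr0.
  rewrite mulr_sumr; apply: eq_bigr => m _; rewrite circuit_coef_perm.
  rewrite delta_perm; last exact: alternating_ext.
  by rewrite mulrCA.
- by move=> s' ->; rewrite eqxx.
move=> I; rewrite (negbTE (indep_tuple_minor I)) /circuit_op sum_ffunE.
under eq_bigr => m _ do rewrite mulrAC mulr_sumr.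
under [RHS]eq_bigr => X cX do rewrite scale_ffunE L_coord // mulr_sumr.
rewrite (exchange_big_dep (circuit b)) /=; last by move=> m X _ /andP[].
apply: eq_bigr => X cX; apply: eq_big => [m|m _]; first by rewrite cX.
by rewrite mulrC.
Qed.

Lemma L_linear X (e : C) x y : L a X (e *: x + y) = e *: L a X x + L a X y.
Proof.
rewrite /L scaler_sumr -big_split; apply: eq_bigr => I _.
by rewrite !ffunE scalerDl scalerA.
Qed.

Lemma circuit_op_linear c (e : C) x y : 
  circuit_op c (e *: x + y) = e *: circuit_op c x + circuit_op c y.
Proof.
rewrite /circuit_op scaler_sumr -big_split; apply: eq_bigr => X _.
by rewrite L_linear scalerDr !scalerA mulrC.
Qed.

(** Each basis vector of V occurs k! times among the k-tuples, and its sign is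
    squared away. *)
Lemma contravariant_ext x y :
  (k`!)%:R * contravariant a x y =
  \sum_(s : {ffun 'I_k -> 'I_n}) (\prod_q a (s q)) * ext x s * ext y s.
Proof.
under [RHS]eq_bigr => s _ do rewrite mulrAC {2}ext.unlock mulr_sumr.
rewrite exchange_big /= /contravariant mulr_sumr; apply: eq_bigr => I _.
under [RHS]eq_bigr => s _ do rewrite mulrCA ffunE mulr_sumr.
rewrite -mulr_sumr exchange_big /=.
rewrite [X in _ = _ * X](eq_bigr (fun=> (\prod_(j <- val I) a j) * y I)) => [|w _].
  by rewrite sumr_const card_Sn -[X in _ = _ * X]mulr_natl; move: _%:R => K; ring.
rewrite (bigD1 (finfun (tnth (val I) \o w))) //= [X in _ + X]big1 ?addr0.
  have -> : finfun (tnth (val I) \o w) = tnth (val I) \o w :> ('I_k -> 'I_n).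
    by apply/funext => i; rewrite ffunE.
  rewrite eqxx mulr1 ext_perm -mulrA [_ * _ * (-1) ^+ w]mulrAC -expr2 sqrr_sign mul1r.
  congr (_ * _); rewrite big_tuple [RHS](reindex_inj (@perm_inj _ w)).
  by apply: eq_bigr.
move=> s ns; case: eqP => [/tup_inj e|]; last by rewrite !mulr0.
by case/eqP: ns; apply/ffunP => i; rewrite ffunE e.
Qed.

(** A sum over pairs (m, s), in which exchanging m with s_q changes the sign of
    delta x; averaging over these exchanges turns y(s) into delta y. *)
Lemma circuit_op_contravariant c x y :
  (k.+1)%:R * ((k`!)%:R * contravariant a (circuit_op c x) y) =
  \sum_(u : 'I_n * {ffun 'I_k -> 'I_n})
    a u.1 * (\prod_q a (u.2 q)) * circuit_coef (b := b) c u.1 u.2 *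
    (delta (ext x) u.1 u.2 * delta (ext y) u.1 u.2).
Proof.
pose G (u : 'I_n * {ffun 'I_k -> 'I_n}) := a u.1 * (\prod_q a (u.2 q)) *
   circuit_coef (b := b) c u.1 u.2 * delta (ext x) u.1 u.2.
have -> : (k`!)%:R * contravariant a (circuit_op c x) y = \sum_u G u * ext y u.2.
  rewrite contravariant_ext -(pair_big xpredT xpredT (fun m (s : {ffun _}) => G (m, s) * ext y s)).
  rewrite exchange_big /=; apply: eq_bigr => s _.
  have [ds|ds] := eqVneq (minor b s) 0.
    by rewrite ext_eq0 // mulr0 mul0r big1 // => m _; rewrite ext_eq0 // mulr0.
  rewrite ext_circuit_op // mulr_sumr mulr_suml; apply: eq_bigr => m _.
  by rewrite /G /=; ring.
pose h q (u : 'I_n * {ffun 'I_k -> 'I_n}) := (u.2 q, finfun (upd u.2 q u.1)).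
have hE q u : (h q u).2 = upd u.2 q u.1 :> ('I_k -> 'I_n).
  by apply/funext => i; rewrite ffunE.
have hK q : involutive (h q).
  move=> [m s]; rewrite /h /= ffunE upd_eq; congr pair; apply/ffunP => i.
  by rewrite ffunE /upd ffunE /upd; case: eqP => // ->.
have hG q u : G (h q u) = - G u.
  rewrite /G /= hE delta_exchange; last exact: alternating_ext.
  rewrite circuit_coef_exchange upd_id mulrN; congr (- (_ * _ * _)).
  rewrite (bigD1 q) //= [in RHS](bigD1 q) //= upd_eq mulrCA.
  congr (_ * (_ * _)); apply: eq_bigr => i ni.
  by rewrite /upd (negbTE ni).
transitivity (\sum_u G u * ext y u.2 - \sum_(q < k) \sum_u G u * ext y (upd u.2 q u.1)).
  rewrite [X in _ = _ - X](eq_bigr (fun=> - \sum_u G u * ext y u.2)).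
    by rewrite sumr_const card_ord mulNrn opprK -mulrS mulr_natl.
  move=> q _; rewrite (reindex_inj (inv_inj (hK q))) -sumrN.
  apply: eq_bigr => u _; rewrite hG mulNr; congr (- (_ * ext y _)).
  by rewrite hE /= upd_upd upd_id.
rewrite exchange_big -sumrB; apply: eq_bigr => u _.
by rewrite -mulr_sumr -mulrBr /G /delta !mulrA.
Qed.

Lemma contravariantC x y : contravariant a x y = contravariant a y x.
Proof. by apply: eq_bigr => I _; rewrite mulrAC. Qed.

Lemma natr_neq0 (m : nat) : (m.+1)%:R != 0 :> C.
Proof. by rewrite pnatr_eq0. Qed.

Lemma circuit_op_sym c x y :
  contravariant a (circuit_op c x) y = contravariant a x (circuit_op c y).
Proof.
rewrite [RHS]contravariantC.
have fn0 : (k`!)%:R != 0 :> C by rewrite pnatr_eq0 -lt0n fact_gt0.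
apply: (mulfI fn0); apply: (mulfI (natr_neq0 k)); rewrite !circuit_op_contravariant.
by apply: eq_bigr => u _; congr (_ * _); rewrite mulrC.
Qed.

End Operators.

(** * Singular vectors and commutation *)

(** The identity w1 /\ w2 + w2 /\ w3 + w3 /\ w1 = 0 for w_r = d f_r / f_r when
    E f3 = A f2 - B f1, evaluated on two coordinate directions i and j, with
    F_r the derivatives of f_r.  If one of A, B vanishes, two of the f_r are
    proportional and the corresponding wedge product is zero, which is why the
    factors (A != 0) and (B != 0) are harmless.  An f_r that vanishes at the
    point is identically zero by assumption, and then w_r counts as 0. *)
Lemma three_term {C : fieldType} (E A B F1i F2i F3i F1j F2j F3j f1 f2 f3 : C) :
  E != 0 -> (A != 0) || (B != 0) ->
  E * F3i = A * F2i - B * F1i -> E * F3j = A * F2j - B * F1j ->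
  E * f3 = A * f2 - B * f1 ->
  (f1 = 0 -> F1i = 0 /\ F1j = 0) -> (f2 = 0 -> F2i = 0 /\ F2j = 0) ->
  (f3 = 0 -> F3i = 0 /\ F3j = 0) ->
  F1i / f1 * (F2j / f2) - F1j / f1 * (F2i / f2)
    - (A != 0)%:R * (F1i / f1 * (F3j / f3) - F1j / f1 * (F3i / f3))
    + (B != 0)%:R * (F2i / f2 * (F3j / f3) - F2j / f2 * (F3i / f3)) = 0.
Proof.
move=> E0 AB ei ej e h1 h2 h3.
have {}ei : F3i = (A * F2i - B * F1i) / E by rewrite -ei mulrC mulKf.
have {}ej : F3j = (A * F2j - B * F1j) / E by rewrite -ej mulrC mulKf.
have {}e : f3 = (A * f2 - B * f1) / E by rewrite -e mulrC mulKf.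
have -> : (A != 0)%:R * (F1i / f1 * (F3j / f3) - F1j / f1 * (F3i / f3)) =
    F1i / f1 * (F3j / f3) - F1j / f1 * (F3i / f3).
  have [A0|] := eqVneq A 0; last by rewrite mul1r.
  by rewrite mul0r ei ej A0; ring.
have -> : (B != 0)%:R * (F2i / f2 * (F3j / f3) - F2j / f2 * (F3i / f3)) =
    F2i / f2 * (F3j / f3) - F2j / f2 * (F3i / f3).
  have [B0|] := eqVneq B 0; last by rewrite mul1r.
  by rewrite mul0r ei ej B0; ring.
have [f10|f10] := eqVneq f1 0.
  by have [-> ->] := h1 f10; rewrite ei ej; have [-> ->] := h1 f10; ring.
have [f20|f20] := eqVneq f2 0.
  by have [-> ->] := h2 f20; rewrite ei ej; have [-> ->] := h2 f20; ring.
have [f30|f30] := eqVneq f3 0.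
  have [i0 j0] := h3 f30; rewrite f30 invr0 !mulr0.
  have eq0 u v : (u - v) / E = 0 -> u = v.
    by move/eqP; rewrite mulf_eq0 invr_eq0 (negbTE E0) orbF subr_eq0 => /eqP.
  have {}ei : A * F2i = B * F1i by apply: eq0; rewrite -ei.
  have {}ej : A * F2j = B * F1j by apply: eq0; rewrite -ej.
  suff e0 : F1i * F2j = F1j * F2i.
    by rewrite !mulf_div e0; ring.
  case/orP: AB => n0; apply: (mulfI n0).
    by rewrite mulrCA ej mulrCA [RHS]mulrCA ei; ring.
  by rewrite mulrA -ei [RHS]mulrA -ej; ring.
have g0 : A * f2 - B * f1 != 0.
  by apply: contraNneq f30 => g0; rewrite e g0 mul0r.
rewrite ei ej e; field.
by rewrite f10 f20 E0 g0.
Qed.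

Section Commutation.
Context {C : numClosedFieldType} {n k : nat} {b : 'M[C]_(n, k)}.
Context (a : 'I_n -> C).
Implicit Types (s : 'I_k -> 'I_n) (X : {set 'I_n}) (m p : 'I_n) (x y : V b).
Implicit Types (c : {set 'I_n} -> C).

(** If neither g_m nor g_p leaves the span of the g_(s_i) with i != q, then m, p
    and these entries do not span. *)
Lemma delta_degenerate x s q m p : minor b s != 0 ->
  minor b (upd s q m) = 0 -> minor b (upd s q p) = 0 ->
  delta (ext x) p (upd s q m) = 0.
Proof.
move=> ds dm dp; rewrite /delta ext_eq0 // (bigD1 q) //= upd_upd ext_eq0 // add0r.
rewrite big1 ?addr0 ?oppr0 // => q' nq; apply: ext_eq0; apply: (mulfI ds).
by rewrite plucker // dm dp !mul0r subr0 mulr0.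
Qed.

(** The condition that x annihilates nu /\ omega_J, with the entry j of nu in
    position q. *)
Definition singular x := forall s q, \sum_j a j * ext x (upd s q j) = 0.

Lemma singular_lin (e : C) x y : singular x -> singular y -> singular (e *: x + y).
Proof.
move=> Sx Sy s q; under eq_bigr => j _ do rewrite ext_lin mulrDr mulrCA.
by rewrite big_split /= -mulr_sumr Sx Sy mulr0 addr0.
Qed.

Context {lambda : {set 'I_n} -> 'I_n -> C} (lambdaP : circuit_relations b lambda).

(** If g_p lies in the span of the g_(s_i) with i != q, the circuit is contained
    in p and these entries, and does not change with the entry in position q. *)
Lemma circuit_coef_indep c p s q m m' : minor b (upd s q m) != 0 ->
  minor b (upd s q m') != 0 -> minor b (upd s q p) = 0 ->
  circuit_coef (b := b) c p (upd s q m) = circuit_coef (b := b) c p (upd s q m').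
Proof.
suff sub u v X : minor b (upd s q u) != 0 -> minor b (upd s q p) = 0 ->
    circuit b X -> X \subset p |: entries (upd s q u) -> X \subset p |: entries (upd s q v).
  move=> dm dm' dp; apply: eq_bigl => X; case cX: (circuit b X) => //=.
  by apply/idP/idP; apply: sub.
move=> du dp cX Xs; apply/fintype.subsetP => i iX.
have := fintype.subsetP Xs i iX; rewrite !in_setU1 => /orP[->//|/imsetP[q' _ iE]].
have [qq|nq] := eqVneq q' q; last first.
  by apply/orP; right; apply/imsetP; exists q'; rewrite // iE /upd (negbTE nq).
have [e0 _ lE] := circuit_fundrel lambdaP _ _ _ du cX Xs.
have := circuit_support lambdaP _ _ cX iX; rewrite lE iE qq fundrel_old //.
  by rewrite upd_upd dp oppr0 mulr0 eqxx.
by apply: contraNneq du => e; rewrite upd_eq in e; rewrite -e dp.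
Qed.

(** The terms (m, p) cancel in pairs by exchange, except those with d = 0 for p in
    position q.  There the circuit coefficient does not depend on m, and what is
    left is a combination of singularity conditions on x. *)
Lemma circuit_op_singular c x : singular x -> singular (circuit_op a c x).
Proof.
move=> Sx s q; pose d m := minor b (upd s q m).
have [/existsP[m0 dm0]|/existsPn dall] := boolP [exists m, d m != 0]; last first.
  apply: big1 => m _; rewrite ext_eq0 ?mulr0 //.
  by apply/eqP; have := dall m; rewrite negbK.
pose W m p := a m * (a p * circuit_coef (b := b) c p (upd s q m) * delta (ext x) p (upd s q m)).
have Wanti m p : W m p = - W p m.
  rewrite /W circuit_coef_exchange delta_swap; last exact: alternating_ext.
  by ring.
transitivity (\sum_(m | d m != 0) \sum_p W m p).
  rewrite [RHS]big_mkcond; apply: eq_bigr => m _; case: ifP => [dm|/negbT].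
    by rewrite ext_circuit_op // mulr_sumr.
  by rewrite negbK => /eqP dm; rewrite ext_eq0 ?mulr0.
under eq_bigr => m _ do rewrite (bigID (fun p => d p != 0)) /=.
rewrite big_split /= [X in X + _ = _](_ : _ = 0) ?add0r; last first.
  apply: eqN_eq0; rewrite {1}exchange_big /= -sumrN; apply: eq_bigr => p _.
  by rewrite -sumrN; apply: eq_bigr => m _; rewrite Wanti.
rewrite (exchange_big_dep (fun p => ~~ (d p != 0))) //=; apply: big1 => p.
rewrite negbK => /eqP dp.
transitivity (a p * circuit_coef (b := b) c p (upd s q m0) *
    \sum_m a m * delta (ext x) p (upd s q m)).
  rewrite mulr_sumr [RHS](bigID (fun m => d m != 0)) /= [X in _ = _ + X]big1 ?addr0.
    apply: eq_big => [m|m /andP[dm _]]; first by rewrite dp eqxx andbT.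
    by rewrite /W (circuit_coef_indep _ _ _ _ m m0) // mulrCA.
  move=> m; rewrite negbK => /eqP dm.
  have := delta_degenerate x (upd s q m0) q m p dm0; rewrite !upd_upd.
  by move=> ->; rewrite ?mulr0.
rewrite (_ : \sum_m _ = 0) ?mulr0 //.
transitivity (\sum_m (a m * ext x (upd s q m)
   - \sum_(q' | q' != q) a m * ext x (upd (upd s q' p) q m))).
  apply: eq_bigr => m _; rewrite /delta (bigD1 q) //= upd_upd.
  rewrite (ext_eq0 _ _ dp) add0r mulrBr mulr_sumr; congr (_ - _).
  by apply: eq_bigr => q' nq; rewrite upd_comm // eq_sym.
rewrite sumrB Sx sub0r exchange_big /= big1 ?oppr0 //.
Qed.

(** The commutator at s is a sum over pairs (m, p) of new indices.  Adding the
    terms of (m, p) and (p, m) and using that the boundary of a boundary vanishes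
    leaves, for each position q, a multiple of delta x on (m, p, s without s_q);
    its coefficient is an instance of [three_term]. *)
Lemma circuit_op_comm (z : 'rV[C]_n) i j x :
  (forall X, circuit b X -> fC lambda X z != 0) ->
  circuit_op a (fun X => lambda X i / fC lambda X z)
    (circuit_op a (fun X => lambda X j / fC lambda X z) x)
  = circuit_op a (fun X => lambda X j / fC lambda X z)
      (circuit_op a (fun X => lambda X i / fC lambda X z) x).
Proof.
move=> z0; apply: ext_inj; apply/funext => s.
have [ds|ds] := eqVneq (minor b s) 0; first by rewrite !ext_eq0.
(* The derivative of log f_C along z_i, for the circuit C in {m} u s. *)
pose r i m s := fundrel b (delta_fun i) m s / fundrel b (z 0) m s.
have rel0 m s' (y : 'I_n -> C) : 
    minor b s' != 0 -> fundrel b (z 0) m s' = 0 -> fundrel b y m s' = 0.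
  move=> ds' zm; have [/imsetP[q _ ->]|ms] := boolP (m \in entries s').
    by rewrite fundrel_mem.
  have [cC Csub] := fund_circuitP lambdaP m s' ds' ms.
  have [c _ lE] := circuit_fundrel lambdaP _ _ _ ds' cC Csub.
  by have := z0 _ cC; rewrite (fC_fundrel _ _ _ _ _ lE) zm mulr0 eqxx.
have K1 l (y : V b) s' : ext (circuit_op a (fun X => lambda X l / fC lambda X z) y) s' =
    \sum_p a p * ((minor b s' != 0)%:R * r l p s' * delta (ext y) p s').
  have [ds'|ds'] := eqVneq (minor b s') 0.
    by rewrite ext_eq0 // big1 // => p _; rewrite !mul0r mulr0.
  rewrite ext_circuit_op //; apply: eq_bigr => p _.
  by rewrite (circuit_coef_fundrel lambdaP) // mul1r !mulrA.
pose U i j m p := r i m s * (r j p s * delta (ext x) p s - \sum_q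
   (minor b (upd s q m) != 0)%:R * r j p (upd s q m) * delta (ext x) p (upd s q m)).
have opopE i' j' : ext (circuit_op a (fun X => lambda X i' / fC lambda X z)
     (circuit_op a (fun X => lambda X j' / fC lambda X z) x)) s =
   \sum_m \sum_p a m * a p * U i' j' m p.
  rewrite K1 ds; apply: eq_bigr => m _; rewrite mul1r /delta K1 ds.
  under [X in _ - X]eq_bigr => q _ do rewrite K1.
  rewrite exchange_big /= -sumrB !mulr_sumr; apply: eq_bigr => p _.
  by rewrite -mulr_sumr -mulrBr mul1r /U; ring.
rewrite !opopE; apply/eqP; rewrite -subr_eq0; apply/eqP.
pose D m p := U i j m p - U j i m p.
transitivity (\sum_m \sum_p a m * a p * D m p).
  rewrite -sumrB; apply: eq_bigr => m _; rewrite -sumrB; apply: eq_bigr => p _.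
  by rewrite mulrBr.
suff Danti m p : D m p = - D p m.
  apply: eqN_eq0; rewrite {1}exchange_big /= -sumrN; apply: eq_bigr => m _.
  by rewrite -sumrN; apply: eq_bigr => p _; rewrite Danti mulrN mulrC [a m * _]mulrC mulrC.
apply/eqP; rewrite -addr_eq0; apply/eqP.
pose g l q := r l p (upd s q m).
pose dq q := delta (ext x) p (upd s q m).
have Ranti (y : 'I_n -> C) q : fundrel b y m (upd s q p) = - fundrel b y p (upd s q m).
  by apply: (mulfI ds); rewrite mulrN !fundrel_plucker // opprB.
have gE l q : r l m (upd s q p) = g l q by rewrite /g /r !Ranti invrN mulrNN.
have dE q : delta (ext x) m (upd s q p) = - dq q.
  by rewrite delta_swap //; apply: alternating_ext.
have dsum : delta (ext x) p s = delta (ext x) m s + \sum_q dq q.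
  by rewrite -delta_delta ?subrKC //; apply: alternating_ext.
have ab0 : (r i m s * r j p s - r j m s * r i p s) * (delta (ext x) p s - delta (ext x) m s)
   = \sum_q (r i m s * r j p s - r j m s * r i p s) * dq q.
  by rewrite dsum addrAC subrr add0r mulr_sumr.
pose ind u q : C := (minor b (upd s q u) != 0)%:R.
pose w1 q := r i m s * g j q - r j m s * g i q.
pose w2 q := r i p s * g j q - r j p s * g i q.
have DE : D m p + D p m =
    (r i m s * r j p s - r j m s * r i p s) * (delta (ext x) p s - delta (ext x) m s)
    - \sum_q ind m q * w1 q * dq q + \sum_q ind p q * w2 q * dq q.
  have UE i' j' u v (h : 'I_k -> C) (e : 'I_k -> C) :
      r i' u s * (r j' v s * delta (ext x) v s - \sum_q ind u q * h q * e q)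
      = r i' u s * r j' v s * delta (ext x) v s
        - \sum_q ind u q * (r i' u s * h q) * e q.
    by rewrite mulrBr mulrA mulr_sumr; congr (_ - _); apply: eq_bigr => q _; ring.
  have Dmp : D m p = r i m s * r j p s * delta (ext x) p s - r j m s * r i p s * delta (ext x) p s
     - \sum_q ind m q * w1 q * dq q.
    rewrite /D /U !UE opprB addrACA [X in _ + X]addrC addrACA; congr (_ + _).
    rewrite -sumrB -sumrN; apply: eq_bigr => q _; rewrite /w1 /g /dq; ring.
  have Dpm : D p m = r i p s * r j m s * delta (ext x) m s - r j p s * r i m s * delta (ext x) m s
     + \sum_q ind p q * w2 q * dq q.
    rewrite /D /U !UE opprB addrACA [X in _ + X]addrC addrACA; congr (_ + _).
    rewrite -sumrB; apply: eq_bigr => q _; rewrite !gE dE /w2; ring.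
  by rewrite Dmp Dpm; ring.
rewrite DE ab0 -sumrB -big_split /=; apply: big1 => q _.
rewrite -mulrBl -mulrDl.
have [/andP[/eqP dm /eqP dp]|AB] :=
  boolP ((minor b (upd s q m) == 0) && (minor b (upd s q p) == 0)).
  by rewrite /dq delta_degenerate // mulr0.
rewrite [X in X * _](_ : _ = 0) ?mul0r //.
apply: (three_term (minor b s) (minor b (upd s q m)) (minor b (upd s q p))) => //.
- by rewrite -negb_and.
- exact: fundrel_plucker.
- exact: fundrel_plucker.
- exact: fundrel_plucker.
- by move=> e; split; apply: rel0.
- by move=> e; split; apply: rel0.
move=> e; move: AB; rewrite negb_and => /orP[dm|dp].
  by split; apply: rel0.
have e' : fundrel b (z 0) m (upd s q p) = 0 by rewrite Ranti e oppr0.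
by split; apply/eqP; rewrite -oppr_eq0 -Ranti; apply/eqP/rel0.
Qed.

Definition conjV x : V b := [ffun I => (x I)^*].

Lemma ext_conj x s : ext (conjV x) s = (ext x s)^*.
Proof.
rewrite ext.unlock rmorph_sum; apply: eq_bigr => I _; rewrite rmorphM ffunE; congr (_ * _).
rewrite ffunE rmorph_sum; apply: eq_bigr => w _.
by rewrite rmorphM rmorph_sign rmorph_nat.
Qed.

Lemma delta_conj x m s : delta (ext (conjV x)) m s = (delta (ext x) m s)^*.
Proof.
rewrite /delta rmorphB rmorph_sum ext_conj; congr (_ - _).
by apply: eq_bigr => q _; rewrite ext_conj.
Qed.

Lemma conjVK : involutive conjV.
Proof. by move=> x; apply/ffunP => I; rewrite !ffunE conjCK. Qed.

(** Paired with the conjugate of x, [circuit_op_contravariant] is a sum of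
    nonnegative terms. *)
Lemma circuit_op_psd c x : (forall j, 0 < a j) -> (forall X, 0 <= c X) ->
  contravariant a (circuit_op a c x) (conjV x) = 0 ->
  forall m s, circuit_coef (b := b) c m s != 0 -> delta (ext x) m s = 0.
Proof.
move=> a0 c0 Kx m s kms.
have k0 m' s' : 0 <= circuit_coef (b := b) c m' s' by apply: sumr_ge0.
have := circuit_op_contravariant a c x (conjV x); rewrite Kx !mulr0 => /esym/eqP.
rewrite psumr_eq0 => [/allP/(_ (m, finfun s))|u _]; last first.
  rewrite delta_conj -normCK !mulr_ge0 ?exprn_ge0 //; first exact: ltW.
  by apply: prodr_ge0 => q _; apply: ltW.
rewrite mem_index_enum => /(_ isT) /=.
have -> : finfun s = s :> ('I_k -> 'I_n) by apply/funext => q; rewrite ffunE.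
rewrite delta_conj !mulf_eq0 (negbTE kms) conjC_eq0 orbb gt_eqF //= orbF.
case/orP => [|/eqP//]; rewrite gt_eqF //; apply: prodr_gt0 => q _; exact: a0.
Qed.
End Commutation.

(** * Orlik-Solomon forms and the subspaces Sing F^k(z) *)

Section Forms.
Context {C : numClosedFieldType} {n : nat}.

Lemma form_sumE {k} {b : 'M[C]_(n, k)} {z p} (I : Type) (r : seq I) (P : pred I)
    (eta : I -> Defs.form b z p) t v :
  (\sum_(i <- r | P i) eta i : Defs.form b z p) t v = \sum_(i <- r | P i) eta i t v.
Proof. by rewrite !fct_sumE. Qed.

Section OS.
Context {k : nat} {b : 'M[C]_(n, k)} {z : 'rV[C]_n}.
Implicit Types (s : 'I_k -> 'I_n).

Lemma f_neq0 (t : complement b z) j : f b j z (val t) != 0.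
Proof. by have /forallP := valP t. Qed.

(** Top degree forms are functions times the volume form det. *)
Lemma omegaE s (t : complement b z) v :
  omega b z [tuple s i | i < k] t v =
  minor b s / (\prod_q f b (s q) z (val t)) * \det v.
Proof.
rewrite /omega /wedge1s minor.unlock.
have -> : \matrix_(l, m) omega1 b z (tnth [tuple s i | i < k] l) t (row m v) =
    diag_mx (\row_q (f b (s q) z (val t))^-1) *m (rowsub s b *m v^T).
  apply/matrixP => l m; rewrite mul_diag_mx !mxE /omega1 tnth_mktuple mulrC /g.
  by congr (_ * _); apply: eq_bigr => i _; rewrite !mxE.
rewrite !det_mulmx det_diag det_tr mulrA; congr (_ * _); rewrite mulrC -prodfV.
by congr (_ * _); apply: eq_bigr => q _; rewrite mxE.
Qed.

Lemma omega_perm s (w : 'S_k) : omega b z [tuple (s \o w) i | i < k] =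
  (-1) ^+ w *: omega b z [tuple s i | i < k].
Proof.
apply/funext => t; apply/funext => v; rewrite !fctE !omegaE alternating_minor.
rewrite -!mulrA; congr (_ * (_ * (_^-1 * _))).
by rewrite [RHS](reindex_inj (@perm_inj _ w)).
Qed.

Lemma omega_dep s : minor b s = 0 -> omega b z [tuple s i | i < k] = 0.
Proof.
move=> ds; apply/funext => t; apply/funext => v.
by rewrite omegaE ds !mul0r.
Qed.

(** The Orlik-Solomon relation of k + 1 hyperplanes (m, s) with a common point. *)
Lemma omega_relation s m : fundrel b (z 0) m s = 0 ->
  omega b z [tuple s i | i < k] = \sum_q 1 *: omega b z [tuple upd s q m i | i < k].
Proof.
move=> R0; apply/funext => t; apply/funext => v; rewrite form_sumE.
under eq_bigr => q _ do rewrite scale1r omegaE.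
rewrite omegaE -mulr_suml; congr (_ * _).
have := fundrel_f b z (val t) m s; rewrite R0 /fundrel => /eqP; rewrite subr_eq0 => /eqP E.
apply: (mulfI (f_neq0 t m)); rewrite mulrA E mulr_suml mulr_sumr.
apply: eq_bigr => q _; rewrite (bigD1 q) //= [in RHS](bigD1 q) //= upd_eq.
have -> : \prod_(i | i != q) f b (upd s q m i) z (val t) =
    \prod_(i | i != q) f b (s i) z (val t).
  by apply: eq_bigr => i ni; rewrite /upd (negbTE ni).
rewrite !invfM !mulrA; congr (_ * _).
rewrite mulrAC mulfV ?mul1r ?f_neq0 //.
by rewrite mulrAC mulfV ?mul1r ?f_neq0.
Qed.

Lemma OS_lin p (c : C) (eta eta' : Defs.form b z p) :
  OS b z p eta -> OS b z p eta' -> OS b z p (c *: eta + eta').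
Proof.
move=> [d ->] [d' ->]; exists (fun J => c * d J + d' J).
rewrite scaler_sumr -big_split; apply: eq_bigr => J _.
by rewrite scalerDl scalerA.
Qed.

Lemma OS_omega p (J : p.-tuple 'I_n) : OS b z p (omega b z J).
Proof.
exists (fun J' => (J' == J)%:R); rewrite (bigD1 J) //= eqxx scale1r.
by rewrite big1 ?addr0 // => J' /negbTE ->; rewrite scale0r.
Qed.

Lemma OS0 p : OS b z p 0.
Proof. by exists (fun=> 0); rewrite big1 // => J _; rewrite scale0r. Qed.

Lemma OSdual0 phi : OSdual b z phi -> phi 0 = 0.
Proof.
move=> dphi; have := dphi 1 0 0 (OS0 _) (OS0 _).
by rewrite scaler0 addr0 mul1r => /eqP; rewrite -subr_eq subrr eq_sym => /eqP.
Qed.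

Lemma OS_sum p (I : Type) (r : seq I) (c : I -> C) (eta : I -> Defs.form b z p) :
  (forall i, OS b z p (eta i)) -> OS b z p (\sum_(i <- r) c i *: eta i).
Proof.
move=> He; elim: r => [|i r IH]; first by rewrite big_nil; apply: OS0.
by rewrite big_cons; apply: OS_lin.
Qed.

Lemma OSdual_sum phi (I : Type) (r : seq I) (c : I -> C) (eta : I -> Defs.form b z k) :
  OSdual b z phi -> (forall i, OS b z k (eta i)) ->
  phi (\sum_(i <- r) c i *: eta i) = \sum_(i <- r) c i * phi (eta i).
Proof.
move=> dphi He; elim: r => [|i r IH]; first by rewrite !big_nil OSdual0.
by rewrite !big_cons dphi ?IH //; apply: OS_sum.
Qed.

(** The equations of F^k(z) in V, see [toV_in_flags] and [in_flags_functional]. *)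
Definition in_flags (x : V b) := forall m s, minor b s != 0 ->
  fundrel b (z 0) m s = 0 -> delta (ext x) m s = 0.

(** The equations are imposed on (m, s) with d(s) != 0; when d(s) = 0, m can be
    exchanged with an entry of s, unless (m, s) does not span at all. *)
Lemma in_flags_adapted x : in_flags x -> adapted b z finset.setT (ext x).
Proof.
move=> Fx; split=> [|s _|m s _ _ R0]; first exact: alternating_ext.
  exact: ext_eq0.
have [ds|ds] := eqVneq (minor b s) 0; last exact: Fx.
have [/existsP[q dq]|/existsPn dall] := boolP [exists q, minor b (upd s q m) != 0].
  apply/eqP; rewrite -oppr_eq0 -(delta_exchange _ _ q) ?alternating_ext //.
    by rewrite Fx // fundrel_exchange R0 oppr0.
  exact: alternating_ext.
rewrite /delta ext_eq0 // big1 ?subr0 // => q _; apply: ext_eq0.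
by apply/eqP; have := dall q; rewrite negbK.
Qed.

Lemma tupleK (J : k.-tuple 'I_n) : [tuple tnth J i | i < k] = J.
Proof. by apply: eq_from_tnth => i; rewrite tnth_mktuple. Qed.

Lemma in_flags_welldef x (c c' : k.-tuple 'I_n -> C) : in_flags x ->
  \sum_J c J *: omega b z J = \sum_J c' J *: omega b z J ->
  \sum_J c J * ext x (tnth J) = \sum_J c' J * ext x (tnth J).
Proof.
move=> Fx e; apply/eqP; rewrite -subr_eq0 -sumrB; apply/eqP.
under eq_bigr => J _ do rewrite -mulrBl.
apply: (completeness b z finset.setT (ext x) (in_flags_adapted x Fx) _ xpredT
          (fun J => c J - c' J) (fun J => tnth J)) => [J _ q|t tA]; first by rewrite inE.
have tc : [forall j, f b j z t != 0] by apply/forallP => j; apply: tA; rewrite inE.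
pose T : complement b z := exist _ t tc.
have := congr1 (fun eta : Defs.form b z k => eta T 1%:M) e; rewrite /= !form_sumE.
move/eqP; rewrite -subr_eq0 -sumrB => /eqP E; rewrite -[RHS]E.
have oE J : omega b z J T 1%:M = minor b (tnth J) / \prod_q f b (tnth J q) z t.
  by rewrite -{1}(tupleK J) omegaE det1 mulr1.
by apply: eq_bigr => J _; rewrite -oE mulrBl.
Qed.

Lemma OSdual_ext phi : OSdual b z phi ->
  ext (toV phi) = fun s => phi (omega b z [tuple s i | i < k]).
Proof.
move=> dphi; apply: ext_uniq => [s w|s ds|I].
- rewrite omega_perm -[_ *: _]addr0 dphi ?OSdual0 ?addr0 //; first exact: OS_omega.
  exact: OS0.
- by rewrite omega_dep // OSdual0.
by rewrite ffunE tupleK.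
Qed.

Lemma toV_in_flags phi : OSdual b z phi -> in_flags (toV phi).
Proof.
move=> dphi m s ds R0; rewrite /delta OSdual_ext // (omega_relation s m R0).
rewrite OSdual_sum // => [|q]; last exact: OS_omega.
by apply/eqP; rewrite subr_eq0; apply/eqP; apply: eq_bigr => q _; rewrite mul1r.
Qed.

(** A form in OS^k(z) has many expressions by the omega_J; completeness makes the
    value computed from any of them the same. *)
Lemma in_flags_functional x : in_flags x -> exists phi : Defs.form b z k -> C,
  [/\ OSdual b z phi, toV phi = x &
      forall J : k.-tuple 'I_n, phi (omega b z J) = ext x (tnth J)].
Proof.
move=> Fx; pose phi (eta : Defs.form b z k) :=
  if pselect (OS b z k eta) is left h then \sum_J projT1 (cid h) J * ext x (tnth J)
  else 0.
have phiE (c : k.-tuple 'I_n -> C) :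
    phi (\sum_J c J *: omega b z J) = \sum_J c J * ext x (tnth J).
  rewrite /phi; case: pselect => [h|[]]; last by exists c.
  by apply: in_flags_welldef => //; case: (cid h) => c' /= <-.
have phiO J : phi (omega b z J) = ext x (tnth J).
  have -> : omega b z J = \sum_J' (J' == J)%:R *: omega b z J'.
    rewrite (bigD1 J) //= eqxx scale1r big1 ?addr0 // => J' /negbTE ->.
    by rewrite scale0r.
  rewrite phiE (bigD1 J) //= eqxx mul1r big1 ?addr0 // => J' /negbTE ->.
  by rewrite mul0r.
exists phi; split=> //.
  move=> c eta eta' [d ->] [d' ->].
  have -> : c *: \sum_J d J *: omega b z J + \sum_J d' J *: omega b z J =
      \sum_J (c * d J + d' J) *: omega b z J.
    rewrite scaler_sumr -big_split; apply: eq_bigr => J _.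
    by rewrite scalerDl scalerA.
  rewrite !phiE mulr_sumr -big_split; apply: eq_bigr => J _.
  by rewrite mulrDl mulrA.
by apply/ffunP => I; rewrite ffunE phiO ext_tnth.
Qed.
End OS.

Lemma wedge_omega {k} (b : 'M[C]_(n, k.+1)) a z (J : k.-tuple 'I_n) :
  wedge (p := k.+1) (nu b a z) (omega b z J) =
  \sum_j a j *: omega b z [tuple of j :: J].
Proof.
apply/funext => t; apply/funext => v; rewrite form_sumE /wedge.
under eq_bigr => i _ do rewrite /nu form_sumE [X in X * _]mulr_sumr mulr_suml.
rewrite exchange_big /=; apply: eq_bigr => j _.
have -> : (a j *: omega b z [tuple of j :: J]) t v =
    a j * omega b z [tuple of j :: J] t v by [].
rewrite /omega /wedge1s (expand_det_row _ ord0) mulr_sumr.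
apply: eq_bigr => i _; rewrite mxE tnth0 /cofactor add0n.
have -> : (a j *: omega1 b z j) t (row i v) = a j * omega1 b z j t (row i v) by [].
rewrite [_ * (a j * _)]mulrCA -!mulrA; congr (_ * _).
rewrite mulrCA; congr (_ * _); rewrite mulrCA; congr (_ * (_ * \det _)).
apply/matrixP => l m; rewrite !mxE tnthS; congr (omega1 b z _ t _).
by apply/rowP => c; rewrite !mxE.
Qed.

Lemma wedge_sum {k} (b : 'M[C]_(n, k.+1)) a z (c : k.-tuple 'I_n -> C) :
  wedge (p := k.+1) (nu b a z) (\sum_J c J *: omega b z J) =
  \sum_J c J *: wedge (p := k.+1) (nu b a z) (omega b z J).
Proof.
apply/funext => t; apply/funext => v; rewrite form_sumE /wedge.
under eq_bigr => i _ do rewrite form_sumE mulr_sumr.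
rewrite exchange_big /=; apply: eq_bigr => J _.
rewrite [RHS]mulr_sumr; apply: eq_bigr => i _.
rewrite -[(c J *: omega b z J) t _]/(c J * omega b z J t (row' i v)).
by rewrite mulrCA.
Qed.

Lemma tnth_cons_fun {k} j (J : k.-tuple 'I_n) : tnth [tuple of j :: J] = cons_fun j (tnth J).
Proof.
apply/funext => i; case: (unliftP ord0 i) => [l|] ->; first by rewrite tnthS cons_funS.
by rewrite tnth0 cons_fun0.
Qed.

Lemma SingFP {k} (b : 'M[C]_(n, k.+1)) a z (x : V b) :
  SingF b a z x <-> in_flags (z := z) x /\ singular a x.
Proof.
split=> [[phi [dphi phi0] <-]|[Fx Sx]].
  split; first exact: toV_in_flags.
  move=> s q; pose J := [tuple s (lift q i) | i < k].
  have := phi0 _ (OS_omega _ J); rewrite wedge_omega OSdual_sum // => [E|j]; last exact: OS_omega.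
  rewrite -[RHS](mulr0 ((-1) ^+ q)) -[X in _ * X]E mulr_sumr; apply: eq_bigr => j _.
  rewrite upd_alternating_cons; last exact: alternating_ext.
  rewrite OSdual_ext // mulrCA; congr (_ * (_ * phi (omega b z _))).
  apply: eq_from_tnth => i; rewrite tnth_mktuple tnth_cons_fun; congr (cons_fun j _ i).
  by apply/funext => l; rewrite tnth_mktuple.
have [phi [dphi phix phiO]] := in_flags_functional x Fx.
exists phi => //; split=> // eta [c ->].
rewrite wedge_sum OSdual_sum // => [|J]; last first.
  by rewrite wedge_omega; apply: OS_sum => j; apply: OS_omega.
apply: big1 => J _; rewrite wedge_omega OSdual_sum // => [|j]; last exact: OS_omega.
under eq_bigr => j _ do rewrite phiO tnth_cons_fun.
have [j0|no_j] := pselect (exists j0 : 'I_n, True); last first.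
  by rewrite big1 ?mulr0 // => j; case: no_j; exists j.
have [j _] := j0; rewrite -[RHS](mulr0 (c J)) -[X in _ = _ * X](Sx (cons_fun j (tnth J)) ord0).
by congr (_ * _); apply: eq_bigr => i _; rewrite upd_cons_fun0.
Qed.
End Forms.

(** * Subspaces and nondegenerate forms *)

Section LinearAlgebra.
Context {K : fieldType} {vT : vectType K}.

(** A subspace of maximal dimension among those contained in P is P. *)
Lemma subspace_vspace (P : vT -> Prop) : P 0 ->
  (forall c u v, P u -> P v -> P (c *: u + v)) ->
  exists U : {vspace vT}, forall x, x \in U <-> P x.
Proof.
move=> P0 Plin; pose Q d := `[< exists2 U : {vspace vT}, \dim U = d & forall x, x \in U -> P x >].
have Q0 : exists d, Q d.
  exists 0%N; apply/asboolP; exists 0%VS; first by rewrite dimv0.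
  by move=> x; rewrite memv0 => /eqP ->.
have Qmax d : Q d -> (d <= \dim {:vT})%N.
  by move=> /asboolP[U <- _]; apply/dimvS/subvf.
case: (ex_maxnP Q0 Qmax) => d /asboolP[U dU UP] maxd; exists U => x.
split=> [|Px]; first exact: UP.
have UxP y : y \in (U + <[x]>)%VS -> P y.
  case/memv_addP => u uU [v /vlineP[c ->] ->].
  by rewrite addrC; apply: Plin => //; apply: UP.
have : (\dim (U + <[x]>) <= \dim U)%N.
  by rewrite dU; apply: maxd; apply/asboolP; exists (U + <[x]>)%VS.
rewrite (geq_leqif (dimv_leqif_sup (addvSl U <[x]>))) => /subvP; apply.
exact/(subvP (addvSr _ _))/memv_line.
Qed.

(** The Gram matrix of a basis of U is invertible.  Applied twice: to the
    contravariant form for orthogonal projections, and to (x, y) |-> S(L0 x, y)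
    for solving L0 p = u. *)
Lemma riesz (B : vT -> vT -> K) (ell : vT -> K) (U : {vspace vT}) :
  (forall c u v w, B (c *: u + v) w = c * B u w + B v w) ->
  (forall c u v w, B w (c *: u + v) = c * B w u + B w v) ->
  (forall c u v, ell (c *: u + v) = c * ell u + ell v) ->
  (forall u, u \in U -> (forall w, w \in U -> B u w = 0) -> u = 0) ->
  exists2 y, y \in U & forall w, w \in U -> B y w = ell w.
Proof.
move=> Bl Br el nd; pose X := vbasis U; pose d : nat := \dim U.
have XU (i : 'I_d) : X`_i \in U by apply: vbasis_mem; apply: mem_nth; rewrite size_tuple.
have lin0 (h : vT -> K) : (forall c u v, h (c *: u + v) = c * h u + h v) -> h 0 = 0.
  by move=> hl; have := hl (-1) 0 0; rewrite scaler0 addr0 mulN1r addNr.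
have linS (h : vT -> K) (r : 'I_d -> K) : (forall c u v, h (c *: u + v) = c * h u + h v) ->
    h (\sum_i r i *: X`_i) = \sum_i r i * h X`_i.
  move=> hl; elim: (index_enum _) => [|i s IH]; first by rewrite !big_nil lin0.
  by rewrite !big_cons hl IH.
pose G := \matrix_(i < d, j < d) B X`_i X`_j.
have BE (r : 'rV_d) (j : 'I_d) : B (\sum_i r 0 i *: X`_i) X`_j = (r *m G) 0 j.
  rewrite (linS (B^~ X`_j)) //; rewrite mxE; apply: eq_bigr => i _.
  by rewrite mxE.
have ext0 (h : vT -> K) : (forall c u v, h (c *: u + v) = c * h u + h v) ->
    (forall i : 'I_d, h X`_i = 0) -> forall w, w \in U -> h w = 0.
  move=> hl h0 w wU; rewrite (coord_vbasis wU) linS // big1 // => i _.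
  by rewrite h0 mulr0.
have uG : G \in unitmx.
  rewrite unitmxE unitfE; apply/negP => /det0P[v v0 vG].
  case/eqP: v0; apply/rowP => i; rewrite mxE.
  have := vbasisP U => /basis_free/freeP/(_ (v 0)); apply.
  apply: nd; first by apply: memv_suml => j _; apply: memvZ.
  apply: ext0 => [c u w|j]; first exact: Br.
  by rewrite BE vG mxE.
pose r := (\row_j ell X`_j) *m invmx G.
exists (\sum_i r 0 i *: X`_i); first by apply: memv_suml => j _; apply: memvZ.
move=> w wU; apply/eqP; rewrite -subr_eq0; apply/eqP.
apply: (ext0 (fun w => B (\sum_i r 0 i *: X`_i) w - ell w)) => // [c u v|j].
  by rewrite Br el mulrBr opprD addrACA.
by rewrite BE mulmxKV // mxE subrr.
Qed.
End LinearAlgebra.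

(** * Generic points and positivity of the contravariant form *)

Section Positivity.
Context {C : numClosedFieldType} {n k : nat} {b : 'M[C]_(n, k.+1)}.
Context {a : 'I_n -> C} (a0 : forall j, 0 < a j).
Context {lambda : {set 'I_n} -> 'I_n -> C} (lambdaP : circuit_relations b lambda).
Implicit Types (x y w : V b) (c : {set 'I_n} -> C).

(** A point on the moment curve: f_C becomes a nonzero polynomial in the
    parameter. *)
Lemma generic_point : exists v : 'rV[C]_n, forall X, circuit b X -> fC lambda X v != 0.
Proof.
pose p X := \sum_(i < n) lambda X i *: 'X^i : {poly C}.
have p0 X : circuit b X -> p X != 0.
  move=> cX; have [[i _ li] _ _] := lambdaP X cX; apply: contraNneq li => e.
  have := congr1 (fun q : {poly C} => q`_i) e; rewrite coef0 coef_sum (bigD1 i) //=.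
  rewrite coefZ coefXn eqxx mulr1 big1 ?addr0 => [->//|j ji].
  by rewrite coefZ coefXn eq_sym (inj_eq val_inj) (negbTE ji) mulr0.
pose P := \prod_(X | circuit b X) p X.
have [e Pe] : exists e, P.[e] != 0.
  apply: contrapT => no_e; have /eqP : P = 0.
    by apply: poly_fun0 => e; apply/eqP; apply/negPn/negP => Pe; apply: no_e; exists e.
  by apply/negP; apply/prodf_neq0 => X; apply: p0.
exists (\row_i e ^+ i) => X cX.
have -> : fC lambda X (\row_i e ^+ i) = (p X).[e].
  rewrite horner_sum; apply: eq_bigr => i _.
  by rewrite mxE hornerZ hornerXn.
by apply: contraNneq Pe => e0; rewrite /P horner_prod (bigD1 X) //= e0 mul0r.
Qed.

Lemma in_flags_generic (z : 'rV[C]_n) x :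
  (forall X, circuit b X -> fC lambda X z != 0) -> in_flags (z := z) x.
Proof.
move=> z0 m s ds R0; have [/imsetP[q _ ->]|ms] := boolP (m \in entries s).
  exact/delta_mem/alternating_ext.
have [cC Csub] := fund_circuitP lambdaP m s ds ms.
have [c _ lE] := circuit_fundrel lambdaP _ _ _ ds cC Csub.
by have := z0 _ cC; rewrite (fC_fundrel _ _ _ _ _ lE) R0 mulr0 eqxx.
Qed.

Lemma SingVP x : SingV b a lambda x <-> singular a x.
Proof.
split=> [[z _ /SingFP[]] //|Sx].
have [v v0] := generic_point; exists v.
  by move=> [X cX e]; have := v0 X cX; rewrite e eqxx.
by apply/SingFP; split=> //; apply: in_flags_generic.
Qed.

Notation B := (contravariant a).

Lemma form_linl (c : C) x y w : B (c *: x + y) w = c * B x w + B y w.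
Proof.
rewrite /contravariant mulr_sumr -big_split; apply: eq_bigr => I _.
by rewrite /= !ffunE /=; rewrite -[c *: x I]/(c * x I); ring.
Qed.

Lemma form_linr (c : C) x y w : B w (c *: x + y) = c * B w x + B w y.
Proof. by rewrite !(contravariantC a w) form_linl. Qed.

Lemma formBl x y w : B (x - y) w = B x w - B y w.
Proof. by rewrite addrC -scaleN1r form_linl mulN1r addrC. Qed.

Lemma conj_a j : (a j)^* = a j.
Proof. by apply: CrealP; apply: gtr0_real. Qed.

Lemma singular_conj x : singular a x -> singular a (conjV x).
Proof.
move=> Sx s q; rewrite -[RHS](conjC0 C) -[X in _ = X^*](Sx s q) rmorph_sum; apply: eq_bigr => j _.
by rewrite rmorphM /= conj_a ext_conj.
Qed.

Lemma in_flags_conj z x : in_flags (z := z) x -> in_flags (z := z) (conjV x).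
Proof. by move=> Fx m s ds R0; rewrite delta_conj Fx // conjC0. Qed.

Lemma form_conj x y : B (conjV x) (conjV y) = (B x y)^*.
Proof.
rewrite /contravariant rmorph_sum; apply: eq_bigr => I _.
rewrite !rmorphM rmorph_prod !ffunE /=; congr (_ * _ * _).
by apply: eq_bigr => j _; rewrite conj_a.
Qed.

(** The bilinear form is definite in the Hermitian sense.  As all subspaces in
    play are stable under conjugation, it is nondegenerate on each of them. *)
Lemma form_definite x : B x (conjV x) = 0 -> x = 0.
Proof.
have pa I : 0 < \prod_(j <- val I : seq 'I_n) a j by apply: prodr_gt0.
move/eqP; rewrite psumr_eq0 => [/allP H|I _]; last first.
  by rewrite ffunE -mulrA -normCK mulr_ge0 ?exprn_ge0 // ltW.
apply/ffunP => I; rewrite [RHS]ffunE.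
have := H I (mem_index_enum _) => /=.
rewrite ffunE -mulrA -normCK mulf_eq0 gt_eqF ?pa //= expf_eq0 /= normr_eq0.
by move/eqP.
Qed.

End Positivity.

(** * The operators at a point z0 of the discriminant *)

Section BadFiber.
Context {C : numClosedFieldType} {n k : nat} {b : 'M[C]_(n, k.+1)}.
Context {a : 'I_n -> C} (a0 : forall j, 0 < a j).
Context {lambda : {set 'I_n} -> 'I_n -> C} (lambdaP : circuit_relations b lambda).
Context (z0 : 'rV[C]_n).
Implicit Types (x y w : V b) (c : {set 'I_n} -> C).
Notation B := (contravariant a).
Notation op := (circuit_op a).
Notation W := (SingF b a z0).

Lemma circuit_op_sumr c (I : Type) (r : seq I) (h : I -> C) (x : I -> V b) :
  op c (\sum_(i <- r) h i *: x i) = \sum_(i <- r) h i *: op c (x i).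
Proof.
have op0 : op c (0 : V b) = 0.
  by have := circuit_op_linear a c (-1) (0 : V b) 0; rewrite scaler0 addr0 scaleN1r addNr.
elim: r => [|i r IH]; first by rewrite !big_nil op0.
by rewrite !big_cons circuit_op_linear IH.
Qed.

Lemma circuit_opZ c (d : C) x : op c (d *: x) = d *: op c x.
Proof.
have := circuit_op_sumr c unit [:: tt] (fun=> d) (fun=> x).
by rewrite !big_seq1.
Qed.

Lemma circuit_op_linl c c' (e : C) x :
  op (fun X => e * c X + c' X) x = e *: op c x + op c' x.
Proof.
rewrite /circuit_op scaler_sumr -big_split; apply: eq_bigr => X _.
by rewrite scalerDl scalerA.
Qed.

Lemma circuit_op_scalel c (e : C) x : op (fun X => e * c X) x = e *: op c x.
Proof.
by rewrite /circuit_op scaler_sumr; apply: eq_bigr => X _; rewrite scalerA.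
Qed.

Lemma eq_circuit_op c c' x : (forall X, circuit b X -> c X = c' X) -> op c x = op c' x.
Proof. by move=> e; apply: eq_bigr => X cX; rewrite e. Qed.

Lemma SingF_lin (c : C) x y : W x -> W y -> W (c *: x + y).
Proof.
move=> /SingFP[Fx Sx] /SingFP[Fy Sy]; apply/SingFP; split; last exact: singular_lin.
move=> m s ds R0; have := Fx m s ds R0; have := Fy m s ds R0.
rewrite /delta => ey ex; rewrite ext_lin.
under eq_bigr => q _ do rewrite ext_lin.
by rewrite big_split /= -mulr_sumr opprD addrACA -mulrBr ex ey mulr0 addr0.
Qed.

Lemma SingF_0 : W 0.
Proof.
have e0 s : ext (0 : V b) s = 0 by rewrite -[0 : V b](scale0r 0) extZ mul0r.
apply/SingFP; split=> [m s _ _|s q].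
  by rewrite /delta e0 big1 ?subr0 // => q _; rewrite e0.
by apply: big1 => j _; rewrite e0 mulr0.
Qed.

Lemma SingF_conj x : W x -> W (conjV x).
Proof.
move=> /SingFP[Fx Sx]; apply/SingFP; split; first exact: in_flags_conj.
exact: singular_conj.
Qed.

Lemma form0l w : B 0 w = 0.
Proof. by rewrite /contravariant big1 // => I _; rewrite ffunE mulr0 mul0r. Qed.

Lemma form0r w : B w 0 = 0.
Proof. by rewrite contravariantC form0l. Qed.

Lemma orth_proj x : exists y, is_orth_proj a W x y.
Proof.
have [U UP] := subspace_vspace W SingF_0 SingF_lin.
have [|y yU yP] := riesz B (B x) U form_linl form_linr (fun e u v => form_linr e u v x).
  move=> u /UP Wu uU; apply: (form_definite a0); apply: uU; exact/UP/SingF_conj.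
exists y; split=> [|w Ww]; first exact/UP.
by rewrite formBl yP ?subrr //; apply/UP.
Qed.

Lemma orth_proj_unique x y y' : is_orth_proj a W x y -> is_orth_proj a W x y' -> y = y'.
Proof.
move=> [Wy yP] [Wy' y'P]; apply/eqP; rewrite -subr_eq0; apply/eqP.
have Wd : W (y - y') by rewrite addrC -scaleN1r; apply: SingF_lin.
have dE : y - y' = (x - y') - (x - y) by rewrite opprB [RHS]addrC addrA subrK.
have Wc := SingF_conj _ Wd.
by apply: (form_definite a0); rewrite {1}dE formBl yP // y'P // subrr.
Qed.

Lemma prP x : is_orth_proj a W x (pr a z0 x).
Proof. by have [y yP] := orth_proj x; apply: (xgetPex 0); exists y. Qed.

(** The orthogonal of Sing F^k(z0) in Sing V. *)
Definition singular_orth x := singular a x /\ forall w, W w -> B x w = 0.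

Lemma singular_orth_lin (c : C) x y :
  singular_orth x -> singular_orth y -> singular_orth (c *: x + y).
Proof.
move=> [Sx Ox] [Sy Oy]; split=> [|w Ww]; first exact: singular_lin.
by rewrite form_linl Ox // Oy // mulr0 addr0.
Qed.

Lemma singular_orth0 : singular_orth 0.
Proof.
have /SingFP[_ S0] := SingF_0; split=> // w _.
exact: form0l.
Qed.

Lemma singular_orth_conj x : singular_orth x -> singular_orth (conjV x).
Proof.
move=> [Sx Ox]; split; first exact: singular_conj.
move=> w Ww; rewrite -(conjVK w) form_conj // Ox ?conjC0 //; exact: SingF_conj.
Qed.

(** The boundary of w vanishes on every (m, s) which contains a circuit C with
    f_C(z0) = 0. *)
Lemma circuit_op_SingF0 c w : (forall X, circuit b X -> fC lambda X z0 != 0 -> c X = 0) ->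
  W w -> op c w = 0.
Proof.
move=> coff /SingFP[Fw _]; apply: ext_inj; apply/funext => s.
rewrite -[0 : V b](scale0r 0) extZ mul0r.
have [ds|ds] := eqVneq (minor b s) 0; first by rewrite ext_eq0.
rewrite ext_circuit_op // big1 // => m _.
have [ms|ms] := boolP (m \in entries s); first by rewrite circuit_coef_mem // mulr0 mul0r.
have [cC Csub] := fund_circuitP lambdaP m s ds ms.
have [c1 _ lE] := circuit_fundrel lambdaP _ _ _ ds cC Csub.
rewrite (circuit_coef_fund lambdaP) //.
have [R0|R0] := eqVneq (fC lambda (fund_circuit (b := b) m s) z0) 0.
  have [c2 c20 lE2] := circuit_fundrel lambdaP _ _ _ ds cC Csub.
  move: R0; rewrite (fC_fundrel _ _ _ _ _ lE2) => /eqP; rewrite mulf_eq0 (negbTE c20) /=.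
  by move/eqP => R0; rewrite Fw // mulr0.
by rewrite coff // mulr0 mul0r.
Qed.

Lemma circuit_op_singular_orth c x : (forall X, circuit b X -> fC lambda X z0 != 0 -> c X = 0) ->
  singular a x -> singular_orth (op c x).
Proof.
move=> coff Sx; split; first exact: (circuit_op_singular a lambdaP).
move=> w Ww; by rewrite circuit_op_sym circuit_op_SingF0 // form0r.
Qed.

(** The coefficients of the operator L0, the sum of the L_C with f_C(z0) = 0. *)
Definition concurrent X : C := (fC lambda X z0 == 0)%:R.

(** If L0 e = 0, positivity makes the boundary of e vanish on all circuits with
    f_C(z0) = 0, so that e lies in Sing F^k(z0) and is orthogonal to it. *)
Lemma L0_definite e : singular_orth e -> op concurrent e = 0 -> e = 0.
Proof.
move=> Ee L0e; have [Se Oe] := Ee.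
have We : W e.
  apply/SingFP; split=> // m s ds R0.
  have [/imsetP[q _ ->]|ms] := boolP (m \in entries s).
    exact/delta_mem/alternating_ext.
  apply: (circuit_op_psd a concurrent) => //.
  - by rewrite L0e; exact: form0l.
  have [cC Csub] := fund_circuitP lambdaP m s ds ms.
  have [c1 _ lE] := circuit_fundrel lambdaP _ _ _ ds cC Csub.
  rewrite (circuit_coef_fund lambdaP) // /concurrent.
  by rewrite (fC_fundrel _ _ _ _ _ lE) R0 mulr0 eqxx oner_neq0.
by apply: (form_definite a0); apply: Oe; apply: SingF_conj.
Qed.

Lemma concurrent_off X : circuit b X -> fC lambda X z0 != 0 -> concurrent X = 0.
Proof. by move=> _ /negbTE e; rewrite /concurrent e. Qed.

Lemma singular_orth_definite e : singular_orth e ->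
  (forall w, singular_orth w -> B e w = 0) -> e = 0.
Proof. by move=> Ee H; apply: (form_definite a0); apply: H; apply: singular_orth_conj. Qed.

(** The form S(L0 x, y) is nondegenerate on [singular_orth]. *)
Lemma L0_surjective u : singular_orth u -> exists2 p, singular_orth p & op concurrent p = u.
Proof.
move=> Eu; have [U UP] := subspace_vspace singular_orth singular_orth0 singular_orth_lin.
have Ll (e : C) x y w : B (op concurrent (e *: x + y)) w
    = e * B (op concurrent x) w + B (op concurrent y) w by rewrite circuit_op_linear form_linl.
have [|p /UP Ep pP] := riesz (fun x y => B (op concurrent x) y) (B u) U
    Ll (fun e x y w => form_linr e x y _) (fun e x y => form_linr e x y u).
  move=> x /UP Ex H; apply: L0_definite => //.
  have EL : singular_orth (op concurrent x).
    by apply: circuit_op_singular_orth concurrent_off _; case: Ex.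
  by apply: singular_orth_definite => // w /UP; apply: H.
exists p => //; apply/eqP; rewrite -subr_eq0; apply/eqP.
apply: singular_orth_definite => [|w /UP wU].
  rewrite addrC -scaleN1r; apply: singular_orth_lin => //.
  by apply: circuit_op_singular_orth concurrent_off _; case: Ep.
by rewrite formBl pP // subrr.
Qed.

Context {v : 'rV[C]_n} (v0 : forall X, circuit b X -> fC lambda X v != 0).

(** Coefficients of M_j, the residue of K_j(z0 + e v) at e = 0. *)
Definition polar j X : C := (fC lambda X z0 == 0)%:R * (lambda X j / fC lambda X v).
(** Coefficients of K_j^1(z0); circuits with f_C(z0) = 0 are left out by the
    convention 1 / 0 = 0. *)
Definition regular j X : C := lambda X j / fC lambda X z0.
Definition fC_line (e : C) X : C := fC lambda X z0 + e * fC lambda X v.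
(** Common denominator of K_j^1(z0 + e v). *)
Definition denom (e : C) : C := \prod_(X | circuit b X && (fC lambda X z0 != 0)) fC_line e X.
Definition regular_num j (e : C) X : C := (fC lambda X z0 != 0)%:R * lambda X j *
  \prod_(X' | (circuit b X' && (fC lambda X' z0 != 0)) && (X' != X)) fC_line e X'.

Lemma polar_off j X : circuit b X -> fC lambda X z0 != 0 -> polar j X = 0.
Proof. by move=> _ /negbTE e; rewrite /polar e mul0r. Qed.

(** Euler's identity \sum_j v_j lambda^C_j = f_C(v). *)
Lemma concurrent_polar X : circuit b X -> concurrent X = \sum_j v 0 j * polar j X.
Proof.
move=> cX; rewrite /concurrent /polar -[LHS]mulr1 -[X in _ * X](mulfV (v0 X cX)) {1}/fC.
rewrite mulr_suml mulr_sumr; apply: eq_bigr => j _.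
by rewrite [RHS]mulrCA; congr (_ * _); rewrite mulrA [v 0 j * _]mulrC.
Qed.

Lemma L0_sum x : op concurrent x = \sum_j v 0 j *: op (polar j) x.
Proof.
rewrite (eq_circuit_op _ (fun X => \sum_j v 0 j * polar j X)); last exact: concurrent_polar.
elim: (index_enum _) => [|j r IH].
  rewrite big_nil; rewrite /circuit_op big1 // => X _; by rewrite big_nil scale0r.
rewrite big_cons -IH -circuit_op_linl; apply: eq_circuit_op => X _; by rewrite big_cons.
Qed.

Lemma fC_lineE e X : fC lambda X (z0 + e *: v) = fC_line e X.
Proof.
rewrite /fC_line /fC mulr_sumr -big_split; apply: eq_bigr => i _.
by rewrite !mxE mulrDr mulrCA.
Qed.

Lemma denom0 : denom 0 != 0.
Proof. by apply/prodf_neq0 => X /andP[_]; rewrite /fC_line mul0r addr0. Qed.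

Lemma regular_num0 j X : circuit b X -> regular_num j 0 X = denom 0 * regular j X.
Proof.
move=> cX; rewrite /regular_num /regular; have [f0|f0] := eqVneq (fC lambda X z0) 0.
  by rewrite f0 invr0 !(mul0r, mulr0).
rewrite mul1r /denom [in RHS](bigD1 X) ?cX //=.
have -> : fC_line 0 X = fC lambda X z0 by rewrite /fC_line mul0r addr0.
by set P := \prod_(_ | _) _; field.
Qed.

(** Coefficients of the polynomial operator e denom(e) K_j(z0 + e v). *)
Definition cleared j (e : C) X : C := denom e * polar j X + e * regular_num j e X.

Lemma cleared_scale j e X : circuit b X -> e != 0 -> denom e != 0 ->
  cleared j e X = e * denom e * (lambda X j / fC lambda X (z0 + e *: v)).
Proof.
move=> cX e0 qe; rewrite fC_lineE /cleared /polar /regular_num.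
have [f0|f0] := eqVneq (fC lambda X z0) 0.
  rewrite /= !mul0r mulr0 addr0 mul1r /fC_line f0 add0r invfM.
  by field; rewrite e0 v0.
have fe0 : fC_line e X != 0 by have /prodf_neq0/(_ X) := qe; rewrite cX f0; apply.
rewrite !mul0r mulr0 add0r mul1r -mulrA; congr (_ * _).
rewrite [in RHS]/denom [in RHS](bigD1 X) ?cX //=.
by set P := \prod_(_ | _) _; field.
Qed.

Definition polyV (x : C -> V b) := forall I, polyfun (fun e => x e I).

Lemma polyfun_ext (h h' : C -> C) : h =1 h' -> polyfun h -> polyfun h'.
Proof. by move=> hh [p ph]; exists p => e; rewrite -hh. Qed.

Lemma polyV_circuit_op (c : C -> {set 'I_n} -> C) (x : C -> V b) :
  (forall X, polyfun (fun e => c e X)) -> polyV x -> polyV (fun e => op (c e) (x e)).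
Proof.
move=> pc px I.
apply: (polyfun_ext (fun e => \sum_(X | circuit b X) c e X *
    \sum_(I' : indep_tuple b) x e I' * L_basis a X I' I)).
  move=> e; rewrite /circuit_op sum_ffunE; apply: eq_bigr => X _; rewrite scale_ffunE /L sum_ffunE.
  by congr (_ * _); apply: eq_bigr => I' _; rewrite scale_ffunE.
apply: polyfun_sum => X _; apply: polyfunM => //; apply: polyfun_sum => I' _.
by apply: polyfunM => //; apply: polyfun_cst.
Qed.

Lemma polyV_cst x : polyV (fun=> x).
Proof. by move=> I; apply: polyfun_cst. Qed.

Lemma polyfun_form (x y : C -> V b) : polyV x -> polyV y -> polyfun (fun e => B (x e) (y e)).
Proof.
move=> px py; apply: polyfun_sum => I _; apply: polyfunM => //.
by apply: polyfunM => //; apply: polyfun_cst.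
Qed.

Lemma polyfun_fC_line X : polyfun (fun e => fC_line e X).
Proof.
apply: polyfunD; first exact: polyfun_cst.
by apply: polyfunM; [exact: polyfun_id|exact: polyfun_cst].
Qed.

Lemma polyfun_denom : polyfun denom.
Proof. by apply: polyfun_prod => X _; apply: polyfun_fC_line. Qed.

Lemma polyfun_regular_num j X : polyfun (fun e => regular_num j e X).
Proof.
apply: polyfunM; first exact: polyfun_cst.
by apply: polyfun_prod => X' _; apply: polyfun_fC_line.
Qed.

Lemma polyfun_cleared j X : polyfun (fun e => cleared j e X).
Proof.
apply: polyfunD; apply: polyfunM; first exact: polyfun_denom.
- exact: polyfun_cst.
- exact: polyfun_id.
exact: polyfun_regular_num.
Qed.

Lemma polyV_cleared j (x : C -> V b) : polyV x -> polyV (fun e => op (cleared j e) (x e)).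
Proof. by apply: polyV_circuit_op => X; apply: polyfun_cleared. Qed.

Lemma polyV_regular_num j x : polyV (fun e => op (regular_num j e) x).
Proof.
by apply: polyV_circuit_op => [X|]; [exact: polyfun_regular_num|exact: polyV_cst].
Qed.

Lemma cleared_comm i j e x : e != 0 -> denom e != 0 ->
  op (cleared i e) (op (cleared j e) x) = op (cleared j e) (op (cleared i e) x).
Proof.
move=> e0 qe.
have gen X : circuit b X -> fC lambda X (z0 + e *: v) != 0.
  move=> cX; rewrite fC_lineE; have [f0|f0] := eqVneq (fC lambda X z0) 0.
    by rewrite /fC_line f0 add0r mulf_neq0 // v0.
  by have /prodf_neq0/(_ X) := qe; rewrite cX f0; apply.
have deE l y : op (cleared l e) y = (e * denom e) *:
    op (fun X => lambda X l / fC lambda X (z0 + e *: v)) y.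
  by rewrite -circuit_op_scalel; apply: eq_circuit_op => X cX; rewrite cleared_scale.
by rewrite !deE !circuit_opZ (circuit_op_comm a lambdaP).
Qed.

Lemma limitV (x y : C -> V b) : polyV x -> polyV y ->
  (forall e, e != 0 -> denom e != 0 -> x e = y e) -> x 0 = y 0.
Proof.
move=> px py xy; apply/ffunP => I; apply/eqP; rewrite -subr_eq0; apply/eqP.
apply: (polyfun_limit (fun e => x e I - y e I) _ _ polyfun_denom denom0).
  exact: polyfunB.
by move=> e e0 qe; rewrite xy // subrr.
Qed.

Lemma cleared0 j x : op (cleared j 0) x = denom 0 *: op (polar j) x.
Proof.
by rewrite -circuit_op_scalel; apply: eq_circuit_op => X _; rewrite /cleared mul0r addr0.
Qed.

Lemma circuit_op_regular_num0 j x : op (regular_num j 0) x = denom 0 *: op (regular j) x.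
Proof. by rewrite -circuit_op_scalel; apply: eq_circuit_op => X cX; rewrite regular_num0. Qed.

(** The coefficient of e^-2 in the commutator of the K_j(z0 + e v). *)
Lemma polar_comm i j x : op (polar i) (op (polar j) x) = op (polar j) (op (polar i) x).
Proof.
have := limitV (fun e => op (cleared i e) (op (cleared j e) x))
   (fun e => op (cleared j e) (op (cleared i e) x)) _ _ _.
rewrite !cleared0 !circuit_opZ => H; apply: (scalerI denom0); apply: (scalerI denom0); apply: H.
- exact/polyV_cleared/polyV_cleared/polyV_cst.
- exact/polyV_cleared/polyV_cleared/polyV_cst.
by move=> e e0 qe; apply: cleared_comm.
Qed.

Lemma cleared_SingF j e w : W w -> op (cleared j e) w = e *: op (regular_num j e) w.
Proof.
move=> Ww; rewrite /cleared circuit_op_linl (circuit_op_SingF0 (polar j)) //; last exact: polar_off.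
by rewrite scaler0 add0r circuit_op_scalel.
Qed.

Lemma cleared_num_comm i j e w : W w -> e != 0 -> denom e != 0 ->
  op (cleared i e) (op (regular_num j e) w) = op (cleared j e) (op (regular_num i e) w).
Proof.
move=> Ww e0 qe; apply: (scalerI e0).
rewrite -(circuit_opZ (cleared i e)) -(circuit_opZ (cleared j e)) -!cleared_SingF //.
exact: cleared_comm.
Qed.

(** The coefficient of e^-1 in the commutator of the K_j(z0 + e v), applied to
    w, on which the M_j vanish. *)
Lemma polar_regular_comm i j w : W w ->
  op (polar i) (op (regular j) w) = op (polar j) (op (regular i) w).
Proof.
move=> Ww; have := limitV (fun e => op (cleared i e) (op (regular_num j e) w))
   (fun e => op (cleared j e) (op (regular_num i e) w)) _ _ _.
rewrite !cleared0 !circuit_op_regular_num0 !circuit_opZ => H.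
apply: (scalerI denom0); apply: (scalerI denom0); apply: H.
- exact/polyV_cleared/polyV_regular_num.
- exact/polyV_cleared/polyV_regular_num.
by move=> e e0 qe; apply: cleared_num_comm.
Qed.

Lemma formZl (d : C) x y : B (d *: x) y = d * B x y.
Proof. by rewrite -[d *: x]addr0 form_linl form0l addr0. Qed.

Lemma formZr (d : C) x y : B x (d *: y) = d * B x y.
Proof. by rewrite contravariantC formZl contravariantC. Qed.

(** The constant coefficient of the commutator, paired with vectors on which the
    M_j vanish: the terms which mix M_i with the derivative of K_j^1 drop out. *)
Lemma regular_pairing i j w w' : W w -> W w' ->
  B (op (regular j) w) (op (regular i) w') = B (op (regular i) w) (op (regular j) w').
Proof.
move=> Ww Ww'.
pose h (e : C) := B (op (regular_num j e) w) (op (regular_num i e) w')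
   - B (op (regular_num i e) w) (op (regular_num j e) w').
have : h 0 = 0.
  apply: (polyfun_limit h denom _ polyfun_denom denom0).
    by apply: polyfunB; apply: polyfun_form; apply: polyV_regular_num.
  move=> e e0 qe; apply: (mulfI e0); rewrite mulr0 mulrBr -!formZr -!cleared_SingF //.
  by rewrite -!circuit_op_sym cleared_num_comm // subrr.
rewrite /h !circuit_op_regular_num0 !formZl !formZr => /eqP; rewrite subr_eq0 => /eqP.
by move/(mulfI denom0)/(mulfI denom0).
Qed.

Lemma SingF_singular w : W w -> singular a w.
Proof. by case/SingFP. Qed.

Let normal_part j w := op (regular j) w - pr a z0 (op (regular j) w).

Lemma normal_singular_orth j w : W w -> singular_orth (normal_part j w).
Proof.
move=> Ww; have [Wp pP] := prP (op (regular j) w); split=> //.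
have Sk : singular a (op (regular j) w).
  by apply: (circuit_op_singular a lambdaP); apply: SingF_singular.
have Sp := SingF_singular _ Wp; rewrite /normal_part addrC -scaleN1r.
exact: singular_lin.
Qed.

Lemma polar_normal i j w : W w -> op (polar i) (normal_part j w) = op (polar j) (normal_part i w).
Proof.
move=> Ww; have polar_reg l m : op (polar l) (normal_part m w) = op (polar l) (op (regular m) w).
  have [Wp _] := prP (op (regular m) w).
  rewrite /normal_part addrC -scaleN1r circuit_op_linear.
  by rewrite (circuit_op_SingF0 (polar l)) ?scaler0 ?add0r //; apply: polar_off.
by rewrite !polar_reg polar_regular_comm.
Qed.

Lemma L0_polar_comm i x : op concurrent (op (polar i) x) = op (polar i) (op concurrent x).
Proof.
rewrite !L0_sum circuit_op_sumr; apply: eq_bigr => j _; by rewrite polar_comm.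
Qed.

Lemma polar_singular_orth j x : singular_orth x -> singular_orth (op (polar j) x).
Proof. by move=> [Sx _]; apply: circuit_op_singular_orth => //; apply: polar_off. Qed.

(** If L0 p is the sum of the v_j u_j, where u_j is [normal_part j w], then
    L0 u_i = \sum_j v_j M_j u_i = \sum_j v_j M_i u_j = M_i L0 p = L0 M_i p, and L0
    is injective on [singular_orth]. *)
Lemma normal_potential w : W w -> exists p, forall i, normal_part i w = op (polar i) p.
Proof.
move=> Ww; have Euv : singular_orth (\sum_j v 0 j *: normal_part j w).
  elim: (index_enum _) => [|j r IH]; first by rewrite big_nil; apply: singular_orth0.
  by rewrite big_cons; apply: singular_orth_lin => //; apply: normal_singular_orth.
have [p Ep pE] := L0_surjective _ Euv; exists p => i.
apply/eqP; rewrite -subr_eq0; apply/eqP; apply: L0_definite.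
  rewrite addrC -scaleN1r; apply: singular_orth_lin; first exact: polar_singular_orth.
  exact: normal_singular_orth.
rewrite addrC -scaleN1r circuit_op_linear L0_polar_comm pE scaleN1r addrC L0_sum circuit_op_sumr.
by rewrite -sumrB big1 // => j _; rewrite polar_normal // subrr.
Qed.

Lemma normal_pairing i j w w' : W w -> W w' ->
  B (normal_part j w) (normal_part i w') = B (normal_part i w) (normal_part j w').
Proof.
move=> /normal_potential[p pE] /normal_potential[p' pE']; rewrite !pE !pE'.
by rewrite -!circuit_op_sym polar_comm.
Qed.

Lemma K1_circuit_op j x : K1 a lambda z0 j z0 x = op (regular j) x.
Proof.
rewrite /K1 /circuit_op big_mkcondr; apply: eq_bigr => X _; case: eqVneq => //= f0.
by rewrite /regular f0 invr0 mulr0 scale0r.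
Qed.

Lemma pr_adj x w : W w -> B (pr a z0 x) w = B x w.
Proof.
move=> Ww; have [_ /(_ w Ww)/eqP] := prP x.
by rewrite formBl subr_eq0 => /eqP.
Qed.

Lemma pr_SingF x : W (pr a z0 x).
Proof. by have [] := prP x. Qed.

Lemma prK1_sym j x y : W x -> W y -> B (prK1 a lambda z0 j x) y = B x (prK1 a lambda z0 j y).
Proof.
move=> Wx Wy; rewrite /prK1 pr_adj // [RHS]contravariantC pr_adj //.
by rewrite !K1_circuit_op circuit_op_sym contravariantC.
Qed.

Lemma SingF_definite x : W x -> (forall w, W w -> B x w = 0) -> x = 0.
Proof. by move=> Wx H; apply: (form_definite a0); apply: H; apply: SingF_conj. Qed.

(** The projection and the normal part of a vector are orthogonal to those of the
    opposite kind. *)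
Lemma form_split x y :
  B x y = B (pr a z0 x) (pr a z0 y) + B (x - pr a z0 x) (y - pr a z0 y).
Proof.
have [Wx px] := prP x; have [Wy _] := prP y.
have -> : B (x - pr a z0 x) (y - pr a z0 y) = B (x - pr a z0 x) y.
  rewrite (contravariantC a (x - pr a z0 x)) formBl.
  rewrite (contravariantC a (pr a z0 y)) px // subr0.
  exact: contravariantC.
have -> : B (pr a z0 x) (pr a z0 y) = B (pr a z0 x) y.
  by rewrite (contravariantC a _ (pr a z0 y)) pr_adj // contravariantC.
by rewrite formBl addrCA subrr addr0.
Qed.

(** Both the full pairing [regular_pairing] and its normal part [normal_pairing]
    are symmetric in i and j, hence so is the remaining projected part. *)
Lemma prK1_comm i j x : W x ->
  prK1 a lambda z0 i (prK1 a lambda z0 j x) = prK1 a lambda z0 j (prK1 a lambda z0 i x).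
Proof.
move=> Wx; apply/eqP; rewrite -subr_eq0; apply/eqP; apply: SingF_definite.
  by rewrite addrC -scaleN1r; apply: SingF_lin; apply: pr_SingF.
have split_pair l m w : W w -> B (op (regular m) x) (op (regular l) w) =
   B (prK1 a lambda z0 l (prK1 a lambda z0 m x)) w + B (normal_part m x) (normal_part l w).
  by move=> Ww; rewrite prK1_sym //; [rewrite /prK1 !K1_circuit_op -form_split|exact: pr_SingF].
move=> w Ww; rewrite formBl.
have e : B (prK1 a lambda z0 i (prK1 a lambda z0 j x)) w + B (normal_part j x) (normal_part i w) =
    B (prK1 a lambda z0 j (prK1 a lambda z0 i x)) w + B (normal_part j x) (normal_part i w).
  have e1 := split_pair i j w Ww; have e2 := split_pair j i w Ww.
  have e3 := regular_pairing i j x w Wx Ww; have e4 := normal_pairing i j x w Wx Ww.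
  exact (etrans (esym e1) (etrans e3 (etrans e2 (congr1 _ (esym e4))))).
exact (etrans (congr1 (fun t => t - _) (addIr _ e)) (subrr _)).
Qed.
End BadFiber.

Theorem theorem7p5 (R : realType) (n k : nat) (k_gt0 : (0 < k)%N)
    (k_lt_n : (k < n)%N) (b : 'M[R[i]]_(n, k))
    (g_neq0 : forall j, row j b != 0) (g_span : row_full b)
    (a : 'I_n -> R[i]) (lambda : {set 'I_n} -> 'I_n -> R[i])
    (lambdaP : circuit_relations b lambda)
    (a_gt0 : forall j, 0 < a j) (b_real : forall j i, b j i \is Num.real)
    (z0 : 'rV[R[i]]_n) (z0_Delta : Delta b lambda z0) :
  [/\ (forall j (x : V b), SingF b a z0 x ->
         SingV b a lambda (K1 a lambda z0 j z0 x)),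
      (forall x : V b, SingV b a lambda x ->
         exists! y, is_orth_proj a (SingF b a z0) x y),
      (forall i j (x : V b), SingF b a z0 x ->
         prK1 a lambda z0 i (prK1 a lambda z0 j x) =
         prK1 a lambda z0 j (prK1 a lambda z0 i x)) &
      (forall j (x y : V b), SingF b a z0 x -> SingF b a z0 y ->
         contravariant a (prK1 a lambda z0 j x) y =
         contravariant a x (prK1 a lambda z0 j y))].
Proof.
case: k k_gt0 k_lt_n b g_neq0 g_span lambdaP b_real z0_Delta => [h|k' _ _ b' _ _ lP _ _].
  by case: (notF h).
have [v v0] := generic_point lP.
split=> [j x /SingFP[_ Sx]|x _|i j x|j x y].
- apply/(SingVP lP); rewrite K1_circuit_op.
  exact: (circuit_op_singular a lP).
- have [y yP] := orth_proj a_gt0 z0 x; exists y; split=> // y'.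
  exact: (orth_proj_unique a_gt0 z0).
- exact: (prK1_comm a_gt0 lP z0 v0).
exact: (prK1_sym a_gt0 z0).
Qed.
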